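(* Let $\mathcal{X}_1,\dots,\mathcal{X}_d$ be Polish spaces and, for each $1\le j\le d$, let $k_j:\mathcal{X}_j\times\mathcal{X}_j\to\mathbb{R}$ be a bounded, continuous, point-separating kernel with RKHS $\mathcal{H}_j$. Let $\gamma$ and $\eta$ be Borel probability measures on $\mathcal{X}_1\times\dots\times\mathcal{X}_d$. Then $$\gamma=\eta \quad\text{if and only if}\quad \kappa_{k_1,\dots,k_d}(\gamma)=\kappa_{k_1,\dots,k_d}(\eta),$$ i.e. $\kappa^{\mathbf{i}}_{k_1,\dots,k_d}(\gamma)=\kappa^{\mathbf{i}}_{k_1,\dots,k_d}(\eta)$ for all multi-indices $\mathbf{i}\in\mathbb{N}^d$ of degree at least $1$. Moreover, for every $\mathbf{i}\in\mathbb{N}^d$ with $m=\deg(\mathbf{i})\ge 1$, $$\big\|\kappa^{\mathbf{i}}_{k_1,\dots,k_d}(\gamma)-\kappa^{\mathbf{i}}_{k_1,\dots,k_d}(\eta)\big\|^2_{\mathcal{H}^{\otimes\mathbf{i}}}=\sum_{\pi,\tau\in P(m)}c_\pi c_\tau\Big[\mathbb{E}_{\gamma^{\mathbf{i}}_\pi\otimes\gamma^{\mathbf{i}}_\tau}k^{\otimes\mathbf{i}}(Z,Z')+\mathbb{E}_{\eta^{\mathbf{i}}_\pi\otimes\eta^{\mathbf{i}}_\tau}k^{\otimes\mathbf{i}}(Z,Z')-2\,\mathbb{E}_{\gamma^{\mathbf{i}}_\pi\otimes\eta^{\mathbf{i}}_\tau}k^{\otimes\mathbf{i}}(Z,Z')\Big],$$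 where in each expectation $(Z,Z')=((Z_1,\dots,Z_m),(Z'_1,\dots,Z'_m))$ is distributed according to the indicated product measure.
   Context: A kernel $k$ on $\mathcal{X}$ is point-separating if $x\mapsto k(x,\cdot)$ is injective; bounded means $\sup_{x,x'}k(x,x')<\infty$. For $\mathbf{i}=(i_1,\dots,i_d)\in\mathbb{N}^d$ (nonnegative integers) let $\deg(\mathbf{i})=i_1+\dots+i_d=m$, and for $1\le j\le m$ let $a(j)=l$ when $i_1+\dots+i_{l-1}<j\le i_1+\dots+i_l$. $P(m)$ is the set of partitions of $\{1,\dots,m\}$ into nonempty disjoint blocks; for $\pi\in P(m)$, $|\pi|$ is its number of blocks and $c_\pi=(-1)^{|\pi|-1}(|\pi|-1)!$. Diagonal measure: for $(X_1,\dots,X_d)\sim\gamma$, $\gamma^{\mathbf{i}}$ is the law on $\mathcal{X}_{a(1)}\times\dots\times\mathcal{X}_{a(m)}$ of $(X_1,\dots,X_1,X_2,\dots,X_2,\dots,X_d,\dots,X_d)$ with $X_l$ repeated $i_l$ times. Partition measure: for $\pi=\{\pi_1,\dots,\pi_b\}\in P(m)$, $\gamma^{\mathbf{i}}_\pi$ is the law of a random vector $(Z_1,\dots,Z_m)$ such that the subvectors $(Z_j)_{j\in\pi_1},\dots,(Z_j)_{j\in\pi_b}$ are independent and each $(Z_j)_{j\in\pi_l}$ has the law of $(W_j)_{j\in\pi_l}$ for $W\sim\gamma^{\mathbf{i}}$ (i.e. the product of the block marginals of $\gamma^{\mathbf{i}}$). Define the kernel $k^{\otimes\mathbf{i}}(z,z')=\prod_{j=1}^m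 k_{a(j)}(z_j,z'_j)$ on $\mathcal{X}_{a(1)}\times\dots\times\mathcal{X}_{a(m)}$, whose RKHS is $\mathcal{H}^{\otimes\mathbf{i}}=\mathcal{H}_1^{\otimes i_1}\otimes\dots\otimes\mathcal{H}_d^{\otimes i_d}$ (Hilbert tensor product). The kernelized cumulant of degree $\mathbf{i}$ ($m\ge1$) is $\kappa^{\mathbf{i}}_{k_1,\dots,k_d}(\gamma)=\sum_{\pi\in P(m)}c_\pi\,\mathbb{E}_{Z\sim\gamma^{\mathbf{i}}_\pi}\big[k^{\otimes\mathbf{i}}(Z,\cdot)\big]\in\mathcal{H}^{\otimes\mathbf{i}}$ (Bochner integral), and $\kappa_{k_1,\dots,k_d}(\gamma)=(\kappa^{\mathbf{i}}_{k_1,\dots,k_d}(\gamma))_{\mathbf{i}}$; the degree-zero component is the same constant for every measure. *)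

(* Defs.v *)
From HB Require Import structures.
From mathcomp Require Import all_boot all_order all_algebra all_classical all_reals all_analysis.

Set Implicit Arguments.
Unset Strict Implicit.
Unset Printing Implicit Defensive.
Import Order.TTheory GRing.Theory Num.Theory.
Import numFieldNormedType.Exports.
Local Open Scope classical_set_scope.
Local Open Scope ring_scope.

(* A Polish space, presented with a complete (pseudo)metric inducing its
   topology: Hausdorff (so the pseudometric is a metric) and separable. *)
Definition polish (R : realType) (T : completePseudoMetricType R) : Prop :=
  hausdorff_space T /\ exists D : set T, countable D /\ closure D = setT.

Definition psd_kernel (R : realType) (T : Type) (K : T -> T -> R) : Prop :=
  (forall x y, K x y = K y x) /\
  (forall (n : nat) (a : 'I_n -> R) (x : 'I_n -> T),
      0 <= \sum_(p < n) \sum_(q < n) a p * a q * K (x p) (x q)).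

Definition bounded_kernel (R : realType) (T : Type) (K : T -> T -> R) : Prop :=
  exists M : R, forall x y, K x y <= M.

Definition continuous_kernel (R : realType) (T : topologicalType)
  (K : T -> T -> R) : Prop :=
  continuous (fun p : T * T => K p.1 p.2).

Definition point_separating (R : realType) (T : Type) (K : T -> T -> R) : Prop :=
  injective K.

(* Norm in the RKHS H_K of a function f : T -> R (extended real; +oo iff
   f is not in H_K):  ||f||_{H_K} = sup { <f, g>_{H_K} : g in span k(x,.),
   ||g|| <= 1 }, where for g = sum_p a_p K(x_p, .) one has <f,g> =
   sum_p a_p f(x_p) (reproducing property) and
   ||g||^2 = sum_{p,q} a_p a_q K(x_p,x_q). *)
Definition rkhs_norm (R : realType) (T : Type) (K : T -> T -> R) (f : T -> R)
  : \bar R :=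
  ereal_sup [set r : \bar R | exists (n : nat) (a : 'I_n -> R) (x : 'I_n -> T),
     \sum_(p < n) \sum_(q < n) a p * a q * K (x p) (x q) <= 1 /\
     r = (`| \sum_(p < n) a p * f (x p) |)%:E].

Definition prodX (R : realType) (d : nat) (X : 'I_d -> completePseudoMetricType R) :=
  prod_topology (fun j => X j : ptopologicalType).
HB.instance Definition _ R d X := Pointed.on (@prodX R d X).
HB.instance Definition _ R d X := Topological.on (@prodX R d X).

Definition BorelX (R : realType) (d : nat) (X : 'I_d -> completePseudoMetricType R) :=
  g_sigma_algebraType (@open (@prodX R d X)).

Definition deg (d : nat) (i : 'I_d -> nat) : nat := (\sum_(l < d) i l)%N.

(* The m = deg i tensor slots: slot (l, r) is the r-th copy of X_l, so
   a(l, r) = l.  (Canonically in bijection with {1,...,m}, ordered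
   lexicographically, which is the paper's indexing.) *)
Definition slot (d : nat) (i : 'I_d -> nat) : finType := {l : 'I_d & 'I_(i l)}.

Definition slotpt (R : realType) (d : nat) (X : 'I_d -> completePseudoMetricType R)
  (i : 'I_d -> nat) := forall s : slot i, X (tag s).

Definition kten (R : realType) (d : nat) (X : 'I_d -> completePseudoMetricType R)
  (k : forall j, X j -> X j -> R) (i : 'I_d -> nat)
  (z z' : slotpt X i) : R :=
  \prod_(s : slot i) k (tag s) (z s) (z' s).

Definition partitions (d : nat) (i : 'I_d -> nat) : {set {set {set slot i}}} :=
  ([set P : {set {set slot i}} | finset.partition P [set: slot i]])%SET.

Definition cpart (R : realType) (T : finType) (P : {set {set T}}) : R :=
  (-1) ^+ (#|P|.-1) * ((#|P|.-1)`!)%:R.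

Fixpoint iint_ord (R : realType) (d0 : measure_display) (T : measurableType d0)
  (mu : {measure set T -> \bar R}) (n : nat) : (('I_n -> T) -> R) -> R :=
  match n return (('I_n -> T) -> R) -> R with
  | 0 => fun F => F (fun o : 'I_0 =>
           False_rect T (notF (etrans (esym (ltn0 o)) (ltn_ord o))))
  | n'.+1 => fun F => Rintegral mu setT (fun x : T =>
           iint_ord mu (fun e : 'I_n' -> T =>
             F (fun o : 'I_n'.+1 => if unlift ord0 o is Some o' then e o' else x)))
  end.

Arguments iint_ord {R d0 T} mu n.

Definition iint (R : realType) (d0 : measure_display) (T : measurableType d0)
  (mu : {measure set T -> \bar R}) (I : finType) (F : (I -> T) -> R) : R :=
  iint_ord mu #|I| (fun e => F (fun x => e (enum_rank x))).

(* Given independent copies env(B) ~ gamma (one per subset B of slots),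
   the vector Z with Z_s = (env (block of s))_{a(s)}.  When the copies
   env(B) are i.i.d. gamma, Z has law gamma^i_pi: blocks are independent,
   and inside each block Z has the law of the diagonal vector, i.e. the
   block marginal of gamma^i.  (Copies indexed by non-blocks are unused.) *)
Definition part_vector (R : realType) (d : nat) (X : 'I_d -> completePseudoMetricType R)
  (i : 'I_d -> nat) (P : {set {set slot i}})
  (env : {set slot i} -> @prodX R d X) : slotpt X i :=
  fun s => env (finset.pblock P s) (tag s).

Definition Epart (R : realType) (d : nat) (X : 'I_d -> completePseudoMetricType R)
  (gamma : probability (BorelX X) R) (i : 'I_d -> nat) (P : {set {set slot i}})
  (g : slotpt X i -> R) : R :=
  iint gamma (fun env : {set slot i} -> BorelX X => g (part_vector P env)).

Definition Epart2 (R : realType) (d : nat) (X : 'I_d -> completePseudoMetricType R)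
  (gamma eta : probability (BorelX X) R) (i : 'I_d -> nat)
  (P Q : {set {set slot i}}) (g : slotpt X i -> slotpt X i -> R) : R :=
  iint gamma (fun e1 : {set slot i} -> BorelX X =>
    iint eta (fun e2 : {set slot i} -> BorelX X =>
      g (part_vector P e1) (part_vector Q e2))).

(* The kernelized cumulant kappa^i(gamma) in H^{(x) i}, represented (as
   every element of an RKHS) by its function on X_{a(1)} x ... x X_{a(m)}:
   kappa^i(gamma)(z') = sum_P c_P E_{Z ~ gamma^i_P} k^{(x) i}(Z, z')
   (evaluation commutes with the Bochner integral). *)
Definition kcumulant (R : realType) (d : nat) (X : 'I_d -> completePseudoMetricType R)
  (k : forall j, X j -> X j -> R) (gamma : probability (BorelX X) R)
  (i : 'I_d -> nat) : slotpt X i -> R :=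
  fun z' => \sum_(P in partitions i) cpart R P * Epart gamma P (fun z => kten k z z').

Arguments kten {R d X} k i z z'.
Arguments kcumulant {R d X} k gamma i _.

(* Main.v *)
(**
Cumulants to laws: the one-block partition contributes the full moment
[\int \prod_s k(x_s, z_s)] and all other partitions only moments of smaller
degree, so equal cumulants give equal moments by induction on the degree. The
functions with equal integrals then contain every bounded pointwise limit of
polynomials in the [k_j(., y)]; the indicators among them form a sigma-algebra
that contains every compact set, because countably many [k_j(., y)] are
continuous and separate points. Tightness on Polish spaces extends the equality
from compact to closed sets.

Norm formula: replace each variable [x] by [D_n x], where [D_n] has finite range
and [D_n x --> x]. The measures become finitely supported, where the formula is
the finite quadratic form of the kernel, and bounded convergence passes to the
limit. The kernel on slots is positive semidefinite by Schur's product theorem.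
*)
Require Import Defs.
From HB Require Import structures.
From mathcomp Require Import all_boot all_order all_algebra all_classical all_reals all_analysis.
From mathcomp Require Import measurable_realfun.
From mathcomp Require Import ring lra.
Import Order.TTheory GRing.Theory Num.Theory.
Import numFieldNormedType.Exports.
Local Open Scope classical_set_scope.
Local Open Scope ring_scope.

Set Implicit Arguments.
Unset Strict Implicit.
Unset Printing Implicit Defensive.

(** * Positive semidefinite kernels *)

Section PsdKernel.
Context {R : realType}.

(** Expectations here are iterated integrals, and linearity, limits and exchange of the variables
    call for some form of joint measurability. The class [multivariate], the bounded pointwise
    closure of products of one-variable functions, plays that role: each property is explicit on
    products and passes to sums and bounded limits. Discretization brings the tensor kernel into
    this class, because any function of finite-range variables is a finite sum of such products.

    The norm is a supremum over finite kernel combinations, so no Hilbert space is constructed.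
    Cauchy-Schwarz against the discretized signed measure bounds it from above; that same measure,
    once normalized, is an admissible test combination and approaches the bound.

    The spaces need not be compact, so polynomials in the kernel sections need not be uniformly
    dense among bounded continuous functions. Bounded pointwise limits are weaker, but integrals
    still respect them. *)

Lemma discriminant_le (A B C : R) :
  0 <= A -> (forall t, 0 <= A * t ^+ 2 + 2 * B * t + C) -> B ^+ 2 <= A * C.
Proof.
rewrite le_eqVlt => /predU1P[<-|A0] h.
  have [->|B0] := eqVneq B 0; first by rewrite expr0n mul0r.
  (* With [A = 0] the form is affine, and at this [t] it takes the value -1. *)
  have := h (- (C + 1) / (2 * B)); rewrite mul0r add0r mulrCA divff; last first.
    by rewrite mulf_neq0.
  lra.
have := h (- B / A).
have -> : A * (- B / A) ^+ 2 + 2 * B * (- B / A) + C = (A * C - B ^+ 2) / A.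
  by field; rewrite gt_eqF.
by rewrite pmulr_lge0 ?invr_gt0// subr_ge0.
Qed.

Context {T : Type}.
Implicit Types K : T -> T -> R.

Lemma psd_sum_ge0 K (J : finType) (a : J -> R) (x : J -> T) : psd_kernel K ->
  0 <= \sum_p \sum_q a p * a q * K (x p) (x q).
Proof.
case=> _ /(_ _ (fun i : 'I_#|J| => a (enum_val i)) (fun i => x (enum_val i))).
have reidx (F : J -> R) : \sum_j F j = \sum_i F (@enum_val J J i).
  by rewrite (reindex (@enum_val J J))//; exact/onW_bij/enum_val_bij.
by rewrite reidx; under [in X in _ -> X]eq_bigr do rewrite reidx.
Qed.

(** The form of [K] on the joint family indexed by [J1 + J2], with weights [t * a] and [b], is a
    nonnegative quadratic polynomial in [t]; the bound is its discriminant condition. *)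
Lemma psd_Cauchy_Schwarz K (J1 J2 : finType) (a : J1 -> R) (x : J1 -> T)
    (b : J2 -> R) (y : J2 -> T) : psd_kernel K ->
  (\sum_p \sum_q a p * b q * K (x p) (y q)) ^+ 2 <=
  (\sum_p \sum_q a p * a q * K (x p) (x q)) *
  (\sum_p \sum_q b p * b q * K (y p) (y q)).
Proof.
move=> Kpsd; apply: discriminant_le; first exact: psd_sum_ge0.
move=> t.
pose c (j : J1 + J2) := match j with inl p => t * a p | inr q => b q end.
pose z (j : J1 + J2) := match j with inl p => x p | inr q => y q end.
have := psd_sum_ge0 c z Kpsd; rewrite big_sumType /=.
under eq_bigr do rewrite big_sumType /=.
under [X in _ + X]eq_bigr do rewrite big_sumType /=.
rewrite !big_split /=.
have -> : \sum_i \sum_j t * a i * (t * a j) * K (x i) (x j) =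
   (\sum_p \sum_q a p * a q * K (x p) (x q)) * t ^+ 2.
  rewrite mulr_suml; apply: eq_bigr => i _; rewrite mulr_suml.
  by apply: eq_bigr => j _; ring.
have -> : \sum_i \sum_j t * a i * b j * K (x i) (y j) =
   (\sum_p \sum_q a p * b q * K (x p) (y q)) * t.
  rewrite mulr_suml; apply: eq_bigr => i _; rewrite mulr_suml.
  by apply: eq_bigr => j _; ring.
have -> : \sum_i \sum_j b i * (t * a j) * K (y i) (x j) =
   (\sum_p \sum_q a p * b q * K (x p) (y q)) * t.
  rewrite exchange_big mulr_suml; apply: eq_bigr => i _; rewrite mulr_suml.
  by apply: eq_bigr => j _; rewrite Kpsd.1; ring.
by move=> h; apply: le_trans h _; rewrite le_eqVlt; apply/orP; left; apply/eqP; ring.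
Qed.

Lemma psd_diag_ge0 K x : psd_kernel K -> 0 <= K x x.
Proof.
move=> /(psd_sum_ge0 (fun _ : 'I_1 => 1) (fun=> x)).
by rewrite !big_ord1 /= !mul1r.
Qed.

Lemma psd_sqr_le K x y : psd_kernel K -> K x y ^+ 2 <= K x x * K y y.
Proof.
move=> /(psd_Cauchy_Schwarz (fun _ : 'I_1 => 1) (fun=> x)
  (fun _ : 'I_1 => 1) (fun=> y)).
by rewrite !big_ord1 /= !mul1r.
Qed.

(** [bounded_kernel] bounds from one side only. It confines the diagonal to [0, M], and
    Cauchy-Schwarz then controls the other values in absolute value. *)
Lemma psd_bounded_norm K : psd_kernel K -> bounded_kernel K ->
  exists2 M, 0 <= M & forall x y, `|K x y| <= M.
Proof.
move=> Kpsd [M KM]; have [[x0]|T0] := pselect (inhabited T); last first.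
  by exists 0 => // x; exfalso; apply: T0; exists.
have M0 : 0 <= M by exact: le_trans (psd_diag_ge0 x0 Kpsd) (KM _ _).
exists M => // x y; rewrite -ler_sqr ?nnegrE// -normrX ger0_norm ?sqr_ge0//.
apply: le_trans (psd_sqr_le x y Kpsd) _; rewrite expr2.
by apply: ler_pM => //; exact: psd_diag_ge0.
Qed.

(* In Rocq, dividing by [K x0 x0 = 0] yields 0, and then this is [K] itself. *)
Lemma psd_deflate K x0 : psd_kernel K ->
  psd_kernel (fun x y => K x y - K x x0 * K y x0 / K x0 x0).
Proof.
move=> Kpsd; split=> [x y|n a x].
  by rewrite Kpsd.1 [K x x0 * _]mulrC.
have := psd_Cauchy_Schwarz a x (fun _ : 'I_1 => 1) (fun=> x0) Kpsd.
rewrite !big_ord1 /= !mul1r.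
under eq_bigr do rewrite big_ord1 mulr1.
set c := \sum_(p < n) _ => cQ.
have -> : \sum_(p < n) \sum_(q < n) a p * a q *
    (K (x p) (x q) - K (x p) x0 * K (x q) x0 / K x0 x0) =
  \sum_(p < n) \sum_(q < n) a p * a q * K (x p) (x q) - c ^+ 2 / K x0 x0.
  rewrite expr2 /c mulr_suml mulr_suml -sumrB; apply: eq_bigr => p _.
  rewrite mulr_sumr mulr_suml -sumrB; apply: eq_bigr => q _; ring.
have [->|K0] := eqVneq (K x0 x0) 0.
  by rewrite invr0 mulr0 subr0; exact: psd_sum_ge0.
have {}K0 : 0 < K x0 x0 by rewrite lt_neqAle eq_sym K0 psd_diag_ge0.
by rewrite subr_ge0 ler_pdivrMr.
Qed.

(** Applied at the point removed by deflation: the deflated kernel vanishes there on the diagonal,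
    which forces all later features to vanish at that point. *)
Lemma sum_mul_eq0 (s : seq (T -> R)) x y : \sum_(f <- s) f x ^+ 2 <= 0 ->
  \sum_(f <- s) f x * f y = 0.
Proof.
elim: s => [|f s IH]; first by rewrite !big_nil.
rewrite !big_cons => h.
have h1 : 0 <= f x ^+ 2 by exact: sqr_ge0.
have h2 : 0 <= \sum_(f <- s) f x ^+ 2 by apply: sumr_ge0 => g _; exact: sqr_ge0.
rewrite IH; last lra.
have /eqP : f x ^+ 2 = 0 by lra.
by rewrite sqrf_eq0 => /eqP ->; rewrite mul0r addr0.
Qed.

(* Gram-Schmidt, by iterated deflation; the Bessel inequality on the right is
   what keeps the later feature functions from disturbing the earlier points. *)
Lemma psd_gram K n (x : 'I_n -> T) : psd_kernel K ->
  exists s : seq (T -> R),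
    (forall p q, K (x p) (x q) = \sum_(f <- s) f (x p) * f (x q)) /\
    (forall z, \sum_(f <- s) f z ^+ 2 <= K z z).
Proof.
elim: n x K => [x K Kpsd|n IH x K Kpsd].
  exists [::]; split=> [[]//|z]; rewrite big_nil; exact: psd_diag_ge0.
pose x0 := x ord0.
have K'psd := psd_deflate x0 Kpsd.
have [s [sE sB]] := IH (fun p => x (lift ord0 p)) _ K'psd.
pose f0 z := K z x0 / Num.sqrt (K x0 x0).
have f0E z w : f0 z * f0 w = K z x0 * K w x0 / K x0 x0.
  rewrite /f0 mulrACA -invfM -expr2 sqr_sqrtr//; exact: psd_diag_ge0.
have sx0 w : \sum_(f <- s) f x0 * f w = 0.
  apply: sum_mul_eq0; apply: le_trans (sB _) _.
  have [->|K0] := eqVneq (K x0 x0) 0; first by rewrite mul0r mul0r subrr.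
  by rewrite mulfK// subrr.
have Kx0 w : K w x0 = f0 w * f0 x0.
  (* If [K x0 x0 = 0], the right-hand side is 0 by the convention on inverses, and Cauchy-Schwarz
     makes [K w x0] vanish too. *)
  rewrite f0E; have [K0|K0] := eqVneq (K x0 x0) 0; last by rewrite mulfK.
  have := psd_sqr_le w x0 Kpsd; rewrite K0 mulr0 invr0 mulr0 => h.
  by apply/eqP; rewrite -sqrf_eq0 eq_le h sqr_ge0.
exists (f0 :: s); split=> [p q|z]; last first.
  rewrite big_cons expr2 f0E; have := sB z; lra.
rewrite big_cons.
have [p'|] := unliftP ord0 p => [->|->]; last first.
  by rewrite sx0 addr0 -/x0 Kpsd.1 mulrC Kx0.
have [q'|] := unliftP ord0 q => [->|->]; last first.
  rewrite -/x0 Kx0.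
  by under eq_bigr do rewrite mulrC; rewrite sx0 addr0.
by rewrite -sE f0E; ring.
Qed.

(** Writing [K2] as a Gram matrix on the sample points splits the form of the product into a sum
    over features [f] of forms of [K1] with weights [a p * f (x p)]. *)
Lemma psd_mul K1 K2 : psd_kernel K1 -> psd_kernel K2 ->
  psd_kernel (fun x y => K1 x y * K2 x y).
Proof.
move=> K1psd K2psd; split=> [x y|n a x]; first by rewrite K1psd.1 K2psd.1.
have [s [sE _]] := psd_gram x K2psd.
rewrite (_ : \sum_(p < n) _ = \sum_(f <- s) \sum_(p < n) \sum_(q < n)
    (a p * f (x p)) * (a q * f (x q)) * K1 (x p) (x q)).
  by apply: sumr_ge0 => f _; exact: psd_sum_ge0.
rewrite [RHS]exchange_big; apply: eq_bigr => p _.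
rewrite [RHS]exchange_big; apply: eq_bigr => q _.
by rewrite sE !mulr_sumr; apply: eq_bigr => f _; ring.
Qed.

Lemma psd_prod (I : Type) (r : seq I) (K : I -> T -> T -> R) :
  (forall i, psd_kernel (K i)) ->
  psd_kernel (fun x y => \prod_(i <- r) K i x y).
Proof.
move=> Kpsd; elim: r => [|i r IH].
  split=> [x y|n a x]; first by rewrite !big_nil.
  rewrite (_ : \sum_(p < n) _ = (\sum_(p < n) a p) ^+ 2) ?sqr_ge0//.
  rewrite expr2 mulr_suml; apply: eq_bigr => p _; rewrite mulr_sumr.
  by apply: eq_bigr => q _; rewrite big_nil mulr1.
have := psd_mul (Kpsd i) IH; congr psd_kernel.
by apply/funext => x; apply/funext => y; rewrite big_cons.
Qed.

End PsdKernel.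

Lemma psd_comap {R : realType} {S T : Type} (g : S -> T) (K : T -> T -> R) :
  psd_kernel K -> psd_kernel (fun x y => K (g x) (g y)).
Proof. by move=> Kpsd; split=> [x y|n a x]; [exact: Kpsd.1|exact: Kpsd.2]. Qed.

(** * Bounded pointwise closures of a class of functions *)

Section BoundedPointwiseClosure.
Context {R : realType} {T : Type}.
Implicit Types (A : (T -> R) -> Prop) (f g : T -> R).

(** Limits may be iterated, so induction on this predicate serves as a monotone class argument. The
    bound [M] is uniform in [n] and [x], as bounded convergence requires. Products and scalars are
    not constructors: they are inherited from the base class. *)
Inductive bp_closure A : (T -> R) -> Prop :=
| bp_closure_base f : A f -> bp_closure A f
| bp_closure_add f g : bp_closure A f -> bp_closure A g ->
    bp_closure A (fun x => f x + g x)
| bp_closure_lim (F : nat -> T -> R) f (M : R) :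
    (forall n, bp_closure A (F n)) -> (forall n x, `|F n x| <= M) ->
    (forall x, F n x @[n --> \oo] --> f x) -> bp_closure A f.

Definition bounded_class A := forall f, A f -> exists M, forall x, `|f x| <= M.

Lemma cvg_norm_le (u : nat -> R) (l M : R) : (forall n, `|u n| <= M) ->
  u n @[n --> \oo] --> l -> `|l| <= M.
Proof.
move=> uM ul; apply: (cvgr_to_le (cvg_norm ul)); exact: nearW.
Qed.

Lemma bp_closure_bounded A : bounded_class A -> bounded_class (bp_closure A).
Proof.
move=> Abd f; elim=> {f} [f /Abd//|f g _ [M fM] _ [N gN]|F f M _ _ FM Ff].
  by exists (M + N) => x; rewrite (le_trans (ler_normD _ _))// lerD.
by exists M => x; exact: cvg_norm_le (FM ^~ x) (Ff x).
Qed.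

(** Two inductions: over [g] with [f] fixed in [A], then over [f] with [g] fixed in the closure. *)
Lemma bp_closure_mul A : bounded_class A ->
  (forall f g, A f -> A g -> A (fun x => f x * g x)) ->
  forall f g, bp_closure A f -> bp_closure A g ->
  bp_closure A (fun x => f x * g x).
Proof.
move=> Abd Amul.
(* [bounded_class (eq f)] just says that the fixed factor [f] is bounded. *)
have lim f F g M : bounded_class (eq f) ->
    (forall n, bp_closure A (fun x => f x * F n x)) ->
    (forall n x, `|F n x| <= M) -> (forall x, F n x @[n --> \oo] --> g x) ->
    bp_closure A (fun x => f x * g x).
  move=> /(_ _ erefl)[N fN] fF FM Fg.
  apply: (@bp_closure_lim _ (fun n x => f x * F n x) _ (N * M)) => // [n x|x].
    by rewrite normrM ler_pM.
  by apply: cvgMr; exact: Fg.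
have base f g : A f -> bp_closure A g -> bp_closure A (fun x => f x * g x).
  move=> Af; elim=> {g} [g Ag|g h _ IHg _ IHh|F g M _ IH FM Fg].
  - exact/bp_closure_base/Amul.
  - have -> : (fun x => f x * (g x + h x)) = (fun x => f x * g x + f x * h x).
      by apply/funext => x; rewrite mulrDr.
    exact: bp_closure_add.
  - by apply: lim IH FM Fg => _ <-; exact: Abd.
move=> f g + gA; elim=> {f} [f Af|f h _ IHf _ IHh|F f M _ IH FM Ff].
- exact: base.
- have -> : (fun x => (f x + h x) * g x) = (fun x => f x * g x + h x * g x).
    by apply/funext => x; rewrite mulrDl.
  exact: bp_closure_add.
- rewrite (_ : (fun x => _) = (fun x => g x * f x)); last first.
    by apply/funext => x; rewrite mulrC.
  apply: lim FM Ff => [_ <-|n]; first exact: bp_closure_bounded gA.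
  rewrite (_ : (fun x => _) = (fun x => F n x * g x)); last first.
    by apply/funext => x; rewrite mulrC.
  exact: IH.
Qed.

Lemma bp_closure_sum A (I : Type) (r : seq I) (F : I -> T -> R) :
  A (fun=> 0) -> (forall i, bp_closure A (F i)) ->
  bp_closure A (fun x => \sum_(i <- r) F i x).
Proof.
move=> A0 FA; elim: r => [|i r IH].
  under eq_fun do rewrite big_nil.
  exact: bp_closure_base.
under eq_fun do rewrite big_cons.
exact: bp_closure_add.
Qed.

End BoundedPointwiseClosure.

Lemma bp_closure_comap {R : realType} {S T : Type} (phi : S -> T)
    (A : (T -> R) -> Prop) (B : (S -> R) -> Prop) f :
  (forall g, A g -> B (g \o phi)) -> bp_closure A f -> bp_closure B (f \o phi).
Proof.
move=> AB; elim=> {f} [f /AB|f g _ + _|F f M _ IH FM Ff].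
- exact: bp_closure_base.
- exact: bp_closure_add.
- by apply: bp_closure_lim IH _ _ => [n x|x]; [exact: FM|exact: Ff].
Qed.

(** * Bounded measurable functions under a probability measure *)

Section BoundedIntegral.
Context {d : measure_display} {T : measurableType d} {R : realType}.
Variable mu : probability T R.
Implicit Types f g : T -> R.

Lemma bounded_integrable f M : measurable_fun setT f ->
  (forall x, `|f x| <= M) -> mu.-integrable setT (EFin \o f).
Proof.
move=> mf fM; apply: measurable_bounded_integrable => //.
  by apply: le_lt_trans (ltry 1); exact: probability_le1.
by exists M; split; [exact: num_real|move=> N MN x _ /=; exact: le_trans (fM x) (ltW MN)].
Qed.

Lemma Rintegral_cst_probability (r : R) : Rintegral mu setT (fun=> r) = r.
Proof. by rewrite Rintegral_cst// [X in fine X](probability_setT mu) mulr1. Qed.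

Lemma norm_Rintegral_le f M : measurable_fun setT f ->
  (forall x, `|f x| <= M) -> `|Rintegral mu setT f| <= M.
Proof.
move=> mf fM; have fi := bounded_integrable mf fM.
apply: le_trans (le_normr_Rintegral measurableT fi) _.
rewrite -[leRHS]Rintegral_cst_probability; apply: le_Rintegral => //.
  by apply: (@bounded_integrable _ M); [exact: measurableT_comp|move=> x; rewrite normr_id].
apply: (@bounded_integrable _ `|M|) => //; exact: measurable_cst.
Qed.

Lemma measurable_Rintegral_cvg (F : nat -> T -> R) f M :
  (forall n, measurable_fun setT (F n)) -> (forall n x, `|F n x| <= M) ->
  (forall x, F n x @[n --> \oo] --> f x) ->
  measurable_fun setT f /\
  Rintegral mu setT (F n) @[n --> \oo] --> Rintegral mu setT f.
Proof.
move=> mF FM Ff.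
have mf : measurable_fun setT f.
  by apply: (@measurable_realfun.measurable_fun_cvg _ _ _ _ F) => // x _; exact: Ff.
split=> //.
have fM x : `|f x| <= M by exact: cvg_norm_le (FM ^~ x) (Ff x).
have [|||||_ _ h] := @dominated_convergence _ _ _ mu setT measurableT
    (fun n => EFin \o F n) (EFin \o f) (EFin \o cst M).
- by move=> n; apply/measurable_EFinP; exact: mF.
- exact/measurable_EFinP.
- apply: aeW => x _; apply: cvg_EFin; [exact: nearW|exact: Ff].
- apply: (@bounded_integrable _ `|M|) => //; exact: measurable_cst.
- by apply: aeW => x n _; rewrite lee_fin; exact: FM.
apply: (@fine_cvg _ _ _ _ (fun n => \int[mu]_x (F n x)%:E)%E).
rewrite fineK; first exact: h.
exact/integrable_fin_num/(bounded_integrable mf fM).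
Qed.

End BoundedIntegral.

(** * Iterated integrals *)

Section IteratedIntegral.
Context {R : realType} {d0 : measure_display} {T : measurableType d0}.
Implicit Types (mu nu : probability T R) (I J : finType).

Definition bounded_measurable (h : T -> R) :=
  measurable_fun setT h /\ exists M, forall x, `|h x| <= M.

(** The scalar [c] stands apart from the factors so that every constant is a tensor even when [I] is
    empty. *)
Definition tensor I (G : (I -> T) -> R) := exists c h,
  (forall o, bounded_measurable (h o)) /\ G = fun e => c * \prod_o h o (e o).

Definition multivariate I := bp_closure (@tensor I).

Lemma bounded_measurable1 : bounded_measurable (fun=> 1).
Proof. by split; [exact: measurable_cst|exists 1 => x; rewrite normr1]. Qed.

Lemma bounded_measurableM f g : bounded_measurable f -> bounded_measurable g ->
  bounded_measurable (fun x => f x * g x).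
Proof.
move=> [mf [M fM]] [mg [N gN]]; split; first exact: measurable_funM.
by exists (M * N) => x; rewrite normrM ler_pM.
Qed.

Lemma bounded_measurable_prod (S : Type) (r : seq S) (P : pred S) (h : S -> T -> R) :
  (forall s, bounded_measurable (h s)) ->
  bounded_measurable (fun x => \prod_(s <- r | P s) h s x).
Proof.
move=> hh; elim: r => [|s r IH].
  by under eq_fun do rewrite big_nil; exact: bounded_measurable1.
under eq_fun do rewrite big_cons.
by case: (P s) => //; exact: bounded_measurableM.
Qed.

Lemma tensor_bounded I : bounded_class (@tensor I).
Proof.
move=> G [c [h [hb ->]]]; have /choice[M hM] : forall o, exists M, forall x, `|h o x| <= M.
  by move=> o; exact: (hb o).2.
exists (`|c| * \prod_o M o) => e; rewrite normrM ler_wpM2l// normr_prod.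
by apply: ler_prod => o _; rewrite normr_ge0 hM.
Qed.

Lemma tensor_mul I (F G : (I -> T) -> R) : tensor F -> tensor G ->
  tensor (fun e => F e * G e).
Proof.
move=> [c [h [hb ->]]] [c' [h' [hb' ->]]].
exists (c * c'), (fun o x => h o x * h' o x); split=> [i|].
  exact: bounded_measurableM.
by apply/funext => e; rewrite big_split /= mulrACA.
Qed.

Lemma tensor_cst I c : tensor (fun _ : I -> T => c).
Proof.
exists c, (fun _ _ => 1); split=> [_|]; first exact: bounded_measurable1.
by apply/funext => e; rewrite big1 ?mulr1.
Qed.

Lemma multivariate_mul I (F G : (I -> T) -> R) : multivariate F ->
  multivariate G -> multivariate (fun e => F e * G e).
Proof. exact: bp_closure_mul (@tensor_bounded I) (@tensor_mul I) F G. Qed.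

Lemma multivariate_sum I (S : Type) (r : seq S) (F : S -> (I -> T) -> R) :
  (forall s, multivariate (F s)) ->
  multivariate (fun e => \sum_(s <- r) F s e).
Proof. by move=> FA; apply: bp_closure_sum; [exact: tensor_cst|]. Qed.

Let fcons n (x : T) (e : 'I_n -> T) :=
  fun o : 'I_n.+1 => if unlift ord0 o is Some o' then e o' else x.

Let prod_fcons n (h : 'I_n.+1 -> T -> R) x e :
  \prod_o h o (fcons x e o) = h ord0 x * \prod_(o < n) h (lift ord0 o) (e o).
Proof.
rewrite big_ord_recl /fcons unlift_none; congr (_ * _).
by apply: eq_bigr => o _; rewrite liftK.
Qed.

Let multivariate_slice n (G : ('I_n.+1 -> T) -> R) x :
  multivariate G -> multivariate (fun e => G (fcons x e)).
Proof.
apply: (@bp_closure_comap _ _ _ (fcons x)) => _ [c [h [hb ->]]].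
exists (c * h ord0 x), (fun o => h (lift ord0 o)); split=> // .
by apply/funext => e; rewrite /= prod_fcons mulrA.
Qed.

(** The four properties go through one induction on [n] because they feed each other. Convergence,
    additivity and the product formula in dimension [n] make the inner integral a measurable
    function of the first variable ([sliceM]); the norm bound makes it bounded ([sliceB]). Together
    these justify integrating once more. *)
Lemma iint_ord_spec mu n :
  [/\ (forall F G M, (forall k : nat, multivariate (F k)) ->
        (forall k e, `|F k e| <= M) -> (forall e, F k e @[k --> \oo] --> G e) ->
        iint_ord mu n (F k) @[k --> \oo] --> iint_ord mu n G),
      (forall F G, multivariate F -> multivariate G ->
        iint_ord mu n (fun e => F e + G e) = iint_ord mu n F + iint_ord mu n G),
      (forall c h, (forall o, bounded_measurable (h o)) ->
        iint_ord mu n (fun e => c * \prod_o h o (e o)) =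
        c * \prod_o Rintegral mu setT (h o)) &
      (forall F M, multivariate F -> (forall e, `|F e| <= M) ->
        `|iint_ord mu n F| <= M)].
Proof.
elim: n => [|n [IHcvg IHadd IHprod IHle]].
  by split=> //= c h _; rewrite !big_ord0.
have sliceE (F : ('I_n.+1 -> T) -> R) : iint_ord mu n.+1 F =
  Rintegral mu setT (fun x => iint_ord mu n (fun e => F (fcons x e))) by [].
have sliceM (F : ('I_n.+1 -> T) -> R) : multivariate F ->
    measurable_fun setT (fun x => iint_ord mu n (fun e => F (fcons x e))).
  elim=> {F} [_ [c [h [hb ->]]]|F G mF IHF mG IHG|F f M mF IHF FM Ff].
  - rewrite (_ : (fun x => _) = fun x => c * h ord0 x *
        \prod_(i < n) Rintegral mu setT (h (lift ord0 i))); last first.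
      apply/funext => x; rewrite -IHprod//.
      by congr (iint_ord mu n _); apply/funext => e; rewrite prod_fcons mulrA.
    apply: measurable_funM; last exact: measurable_cst.
    apply: measurable_funM; first exact: measurable_cst.
    exact: (hb ord0).1.
  - rewrite (_ : (fun x => _) = (fun x => iint_ord mu n (fun e => F (fcons x e))) \+
        (fun x => iint_ord mu n (fun e => G (fcons x e)))).
      exact: measurable_funD.
    by apply/funext => x; apply: IHadd; exact: multivariate_slice.
  - apply: (measurable_fun_cvg (h := fun k x =>
      iint_ord mu n (fun e => F k (fcons x e)))) => // x _.
    apply: (IHcvg _ _ M) => [k|k e|e].
    + exact: multivariate_slice.
    + exact: FM.
    + exact: Ff.
have sliceB (F : ('I_n.+1 -> T) -> R) M : multivariate F ->
    (forall e, `|F e| <= M) ->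
    forall x, `|iint_ord mu n (fun e => F (fcons x e))| <= M.
  by move=> mF FM x; apply: IHle => [|e]; [exact: multivariate_slice|exact: FM].
split=> [F G M mF FM FG|F G mF mG|c h hb|F M mF FM].
- rewrite sliceE; under eq_fun do rewrite sliceE.
  apply: (measurable_Rintegral_cvg mu (M := M) _ _ _).2.
  + by move=> k; exact: sliceM.
  + by move=> k x; exact: sliceB.
  + move=> x; apply: (IHcvg _ _ M) => [k|k e|e].
    * exact: multivariate_slice.
    * exact: FM.
    * exact: FG.
- have [M FM] := bp_closure_bounded (@tensor_bounded _) mF.
  have [N GN] := bp_closure_bounded (@tensor_bounded _) mG.
  rewrite !sliceE -RintegralD//.
  + congr (Rintegral _ _ _); apply/funext => x.
    by rewrite IHadd//; exact: multivariate_slice.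
  + exact: (bounded_integrable _ (sliceM _ mF) (sliceB _ _ mF FM)).
  + exact: (bounded_integrable _ (sliceM _ mG) (sliceB _ _ mG GN)).
- rewrite sliceE big_ord_recl.
  have -> : (fun x => iint_ord mu n (fun e => c * \prod_o h o (fcons x e o))) =
     (fun x => h ord0 x * (c * \prod_(i < n) Rintegral mu setT (h (lift ord0 i)))).
    apply/funext => x.
    rewrite mulrCA mulrA -IHprod//; congr (iint_ord mu n _).
    by apply/funext => e; rewrite prod_fcons mulrA.
  rewrite RintegralZr//; first by rewrite mulrCA.
  by have [mh [M hM]] := hb ord0; exact: bounded_integrable hM.
- by rewrite sliceE; apply: norm_Rintegral_le; [exact: sliceM|exact: sliceB].
Qed.

Let prod_enum_rank I (h : I -> T -> R) (e : 'I_#|I| -> T) :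
  \prod_o h o (e (enum_rank o)) = \prod_(j < #|I|) h (enum_val j) (e j).
Proof.
rewrite (reindex (@enum_val I I)) /=; last exact/onW_bij/enum_val_bij.
by apply: eq_bigr => j _; rewrite enum_valK.
Qed.

Let multivariate_enum I (F : (I -> T) -> R) : multivariate F ->
  multivariate (fun e : 'I_#|I| -> T => F (fun x => e (enum_rank x))).
Proof.
apply: (@bp_closure_comap _ _ _ (fun (e : 'I_#|I| -> T) x => e (enum_rank x))) => _ [c [h [hb ->]]].
exists c, (fun j => h (enum_val j)); split=> [j|]; first exact: hb.
by apply/funext => e /=; congr (_ * _); exact: prod_enum_rank.
Qed.

Lemma iint_cvg mu I F G M : (forall k : nat, @multivariate I (F k)) ->
  (forall k e, `|F k e| <= M) -> (forall e, F k e @[k --> \oo] --> G e) ->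
  iint mu (F k) @[k --> \oo] --> iint mu G.
Proof.
move=> mF FM FG; have [h _ _ _] := iint_ord_spec mu #|I|.
apply: (h _ _ M) => [k|k e|e]; [exact: multivariate_enum|exact: FM|exact: FG].
Qed.

Lemma iint_add mu I (F G : (I -> T) -> R) : multivariate F -> multivariate G ->
  iint mu (fun e => F e + G e) = iint mu F + iint mu G.
Proof.
by move=> mF mG; have [_ h _ _] := iint_ord_spec mu #|I|;
  apply: h; exact: multivariate_enum.
Qed.

Lemma iint_tensor mu I c (h : I -> T -> R) :
  (forall o, bounded_measurable (h o)) ->
  iint mu (fun e => c * \prod_o h o (e o)) = c * \prod_o Rintegral mu setT (h o).
Proof.
move=> hb; have [_ _ H _] := iint_ord_spec mu #|I|; rewrite /iint.
rewrite [in RHS](reindex (@enum_val I I)) /=; last exact/onW_bij/enum_val_bij.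
rewrite -H => [|j]; last exact: hb.
by congr (iint_ord mu _ _); apply/funext => e; congr (_ * _); exact: prod_enum_rank.
Qed.

Lemma norm_iint_le mu I (F : (I -> T) -> R) M : multivariate F ->
  (forall e, `|F e| <= M) -> `|iint mu F| <= M.
Proof.
move=> mF FM; have [_ _ _ h] := iint_ord_spec mu #|I|.
by apply: h => [|e]; [exact: multivariate_enum|exact: FM].
Qed.

Lemma iint_cst mu I c : iint mu (fun _ : I -> T => c) = c.
Proof.
transitivity (c * \prod_(o : I) Rintegral mu setT (fun=> 1)).
  rewrite -iint_tensor => [|o]; last exact: bounded_measurable1.
  by congr (iint mu _); apply/funext => e; rewrite big1 ?mulr1.
by rewrite big1 ?mulr1// => o _; exact: Rintegral_cst_probability.
Qed.

Lemma iint_sum mu I (S : Type) (r : seq S) (F : S -> (I -> T) -> R) :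
  (forall s, multivariate (F s)) ->
  iint mu (fun e => \sum_(s <- r) F s e) = \sum_(s <- r) iint mu (F s).
Proof.
move=> mF; elim: r => [|s r IH].
  rewrite big_nil -[RHS](iint_cst mu I); congr (iint mu _).
  by apply/funext => e; rewrite big_nil.
rewrite big_cons -IH -iint_add//; last exact: multivariate_sum.
by congr (iint mu _); apply/funext => e; rewrite big_cons.
Qed.

Lemma multivariate_scale I r (F : (I -> T) -> R) :
  multivariate F -> multivariate (fun e => r * F e).
Proof. by apply: multivariate_mul; exact/bp_closure_base/tensor_cst. Qed.

Lemma iint_scale mu I r (F : (I -> T) -> R) : multivariate F ->
  iint mu (fun e => r * F e) = r * iint mu F.
Proof.
elim=> {F} [_ [c [h [hb ->]]]|F G mF IHF mG IHG|F f M mF IHF FM Ff].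
- rewrite iint_tensor// mulrA -iint_tensor//.
  by congr (iint mu _); apply/funext => e; rewrite mulrA.
- rewrite iint_add// mulrDr -IHF -IHG -iint_add; [|exact: multivariate_scale..].
  by congr (iint mu _); apply/funext => e; rewrite mulrDr.
- have h1 : iint mu (fun e => r * F k e) @[k --> \oo] --> iint mu (fun e => r * f e).
    apply: (iint_cvg (M := `|r| * M)) => [k|k e|e].
    + exact: multivariate_scale.
    + by rewrite normrM ler_wpM2l.
    + by apply: cvgMr; exact: Ff.
  have h2 : r * iint mu (F k) @[k --> \oo] --> r * iint mu f.
    by apply: cvgMr; exact: (iint_cvg (M := M)).
  apply: (cvg_unique _ h1); first exact: Rhausdorff.
  rewrite (_ : (fun k => iint mu (fun e => r * F k e)) = fun k => r * iint mu (F k)).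
    exact: h2.
  by apply/funext => k; exact: IHF.
Qed.

Definition join_env I J (e1 : I -> T) (e2 : J -> T) : I + J -> T :=
  fun s => match s with inl i => e1 i | inr j => e2 j end.

Lemma multivariate_join_left I J (G : (I + J -> T) -> R) e1 :
  multivariate G -> multivariate (fun e2 => G (join_env e1 e2)).
Proof.
apply: (@bp_closure_comap _ _ _ (join_env e1)) => _ [c [h [hb ->]]].
exists (c * \prod_i h (inl i) (e1 i)), (fun j => h (inr j)); split=> //.
by apply/funext => e2 /=; rewrite big_sumType /= mulrA.
Qed.

(** Integrating the right block out of a tensor leaves a tensor in the left block; sums and bounded
    limits follow. *)
Lemma multivariate_iint mu I J (G : (I + J -> T) -> R) : multivariate G ->
  multivariate (fun e1 => iint mu (fun e2 => G (join_env e1 e2))).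
Proof.
elim=> {G} [_ [c [h [hb ->]]]|F G mF IHF mG IHG|F f M mF IHF FM Ff].
- apply: bp_closure_base.
  exists (c * \prod_j Rintegral mu setT (h (inr j))), (fun i => h (inl i)).
  split=> //; apply/funext => e1.
  rewrite mulrAC -iint_tensor => [|j]; last exact: hb.
  by congr (iint mu _); apply/funext => e2; rewrite big_sumType /= mulrA.
- rewrite (_ : (fun e1 => _) = fun e1 => iint mu (fun e2 => F (join_env e1 e2)) +
      iint mu (fun e2 => G (join_env e1 e2))); first exact: bp_closure_add.
  by apply/funext => e1; apply: iint_add; exact: multivariate_join_left.
- apply: (bp_closure_lim (M := M) IHF) => [k e1|e1].
    apply: norm_iint_le => [|e2]; [exact: multivariate_join_left|exact: FM].
  apply: (iint_cvg (M := M)) => [k|k e2|e2]; [exact: multivariate_join_left|exact: FM|exact: Ff].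
Qed.

Lemma iint2_cvg mu nu I J F G M : (forall k : nat, @multivariate (I + J)%type (F k)) ->
  (forall k e, `|F k e| <= M) -> (forall e, F k e @[k --> \oo] --> G e) ->
  iint mu (fun e1 => iint nu (fun e2 => F k (join_env e1 e2))) @[k --> \oo] -->
  iint mu (fun e1 => iint nu (fun e2 => G (join_env e1 e2))).
Proof.
move=> mF FM FG; apply: (iint_cvg (M := M)) => [k|k e1|e1].
- exact: multivariate_iint.
- by apply: norm_iint_le => [|e2]; [exact: multivariate_join_left|exact: FM].
- apply: (iint_cvg (M := M)) => [k|k e2|e2]; [exact: multivariate_join_left|exact: FM|exact: FG].
Qed.

(** Fubini by induction over the closure: both orders are the same product of integrals on tensors.
    The map [swap] carries membership in the class over to the index type [J + I]. *)
Lemma iint_swap mu nu I J (G : (I + J -> T) -> R) : multivariate G ->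
  iint mu (fun e1 => iint nu (fun e2 => G (join_env e1 e2))) =
  iint nu (fun e2 => iint mu (fun e1 => G (join_env e1 e2))).
Proof.
pose swap (e : J + I -> T) : I + J -> T := join_env (e \o inr) (e \o inl).
have mswap F : multivariate F -> multivariate (F \o swap).
  apply: bp_closure_comap => _ [c [h [hb ->]]].
  exists c, (fun s => match s with inl j => h (inr j) | inr i => h (inl i) end).
  split=> [[j|i]//|]; apply/funext => e /=.
  by rewrite !big_sumType /= [X in _ * X]mulrC.
elim=> {G} [_ [c [h [hb ->]]]|F G mF IHF mG IHG|F f M mF IHF FM Ff].
- transitivity (c * \prod_j Rintegral nu setT (h (inr j)) *
      \prod_i Rintegral mu setT (h (inl i))).
    rewrite -iint_tensor => [|i]; last exact: hb.
    congr (iint mu _); apply/funext => e1.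
    rewrite mulrAC -iint_tensor => [|j]; last exact: hb.
    by congr (iint nu _); apply/funext => e2; rewrite big_sumType /= mulrA.
  rewrite mulrAC -iint_tensor => [|j]; last exact: hb.
  congr (iint nu _); apply/funext => e2.
  rewrite mulrAC -iint_tensor => [|i]; last exact: hb.
  by congr (iint mu _); apply/funext => e1; rewrite big_sumType /= mulrA mulrAC.
- transitivity (iint mu (fun e1 => iint nu (fun e2 => F (join_env e1 e2))) +
      iint mu (fun e1 => iint nu (fun e2 => G (join_env e1 e2)))).
    rewrite -iint_add; [|exact: multivariate_iint..].
    congr (iint mu _); apply/funext => e1.
    by apply: iint_add; exact: multivariate_join_left.
  rewrite IHF IHG -iint_add; last 2 first.
  + exact: (multivariate_iint mu (mswap _ mF)).
  + exact: (multivariate_iint mu (mswap _ mG)).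
  congr (iint nu _); apply/funext => e2; symmetry.
  apply: iint_add.
  + exact: (multivariate_join_left e2 (mswap _ mF)).
  + exact: (multivariate_join_left e2 (mswap _ mG)).
- have h1 := @iint2_cvg mu nu I J F f M mF FM Ff.
  have h2 := @iint2_cvg nu mu J I (fun k => F k \o swap) (f \o swap) M
    (fun k => mswap _ (mF k)) (fun k e => FM k _) (fun e => Ff (swap e)).
  apply: (cvg_unique _ h1); first exact: Rhausdorff.
  rewrite (_ : (fun k => _) = fun k => iint nu (fun e2 => iint mu
    (fun e1 => F k (join_env e1 e2)))); first exact: h2.
  by apply/funext => k; exact: IHF.
Qed.

End IteratedIntegral.

(** An integral depends only on the values of the measure on measurable sets, so the measures can be
    exchanged one variable at a time. This gives the direction from laws to cumulants. *)
Lemma iint_eq_measure {R : realType} {d0 : measure_display} {T : measurableType d0}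
    (mu nu : probability T R) (I : finType) (F : (I -> T) -> R) :
  (forall A, measurable A -> mu A = nu A) -> iint mu F = iint nu F.
Proof.
move=> munu; rewrite /iint; move: (fun e => F _); move: #|I| => n {F}.
elim: n => [//|n IH] F /=.
rewrite [LHS]/Rintegral (eq_measure_integral nu); last by move=> A mA _; exact: munu.
by congr fine; apply: eq_integral => x _; rewrite IH.
Qed.

(** * The RKHS norm of a signed combination of embeddings *)

Section Discretization.
Context {R : realType} {d0 : measure_display} {T : measurableType d0}.
Variables (W : finType) (idx : T -> W) (pt : W -> T).
Hypothesis midx : forall w, measurable [set x | idx x = w].

Definition discretize (x : T) := pt (idx x).

Let cell w x : R := (idx x == w)%:R.

Let cell_bm w : bounded_measurable (cell w).
Proof.
split; last first.
  by exists 1 => x; rewrite /cell; case: eqP; rewrite ?normr1 ?normr0.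
rewrite (_ : cell w = \1_[set x | idx x = w]); first exact: measurable_indic.
apply/funext => x; rewrite indicE /cell; congr (_%:R); congr nat_of_bool.
by apply/eqP/idP => [?|]; [rewrite inE|rewrite inE].
Qed.

(** Among all assignments [s] of cells to variables only the one matching [e] survives. Each summand
    is a constant times a product of cell indicators, hence a tensor, for any [F]. *)
Lemma discretizeE (I : finType) (F : (I -> T) -> R) e :
  F (discretize \o e) =
  \sum_(s : {ffun I -> W}) F (pt \o s) * \prod_o cell (s o) (e o).
Proof.
rewrite (bigD1 [ffun o => idx (e o)]) //= big1 => [|o _]; last first.
  by rewrite /cell ffunE eqxx.
rewrite mulr1 big1 ?addr0 => [|s]; last first.
  rewrite eq_sym => /eqP/ffunP/existsNP[i]; rewrite ffunE => /eqP so.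
  by rewrite (bigD1 i) //= {1}/cell (negbTE so) mul0r mulr0.
by congr F; apply/funext => o; rewrite /= ffunE.
Qed.

Lemma multivariate_discretize (I : finType) (F : (I -> T) -> R) :
  multivariate (fun e => F (discretize \o e)).
Proof.
under eq_fun do rewrite discretizeE.
apply: multivariate_sum => s; apply: bp_closure_base.
by exists (F (pt \o s)), (fun o => cell (s o)).
Qed.

(** Only the left block is expanded over cells; each term is an indicator product in the left
    variables times a multivariate function of the right ones, and both are lifted to [I + J] with
    factors 1. *)
Lemma multivariate_discretize_left (I J : finType) (F : (I -> T) -> (J -> T) -> R) :
  (forall e, multivariate (F e)) ->
  multivariate (fun e : I + J -> T => F (discretize \o (e \o inl)) (e \o inr)).
Proof.
move=> mF.
under eq_fun => e do rewrite (discretizeE (F^~ (e \o inr))).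
apply: multivariate_sum => s; apply: multivariate_mul.
  apply: (bp_closure_comap (phi := fun e : I + J -> T => e \o inr) _ (mF _)).
  move=> _ [c [h [hb ->]]].
  exists c, (fun ij => match ij with inl _ => fun=> 1 | inr j => h j end).
  split=> [[i|j]//|]; first exact: bounded_measurable1.
  by apply/funext => e /=; rewrite big_sumType /= [X in _ = _ * (X * _)]big1 ?mul1r.
apply: bp_closure_base.
exists 1, (fun ij => match ij with inl i => cell (s i) | inr _ => fun=> 1 end).
split=> [[i|j]//|]; first exact: bounded_measurable1.
by apply/funext => e /=; rewrite big_sumType /= [X in _ = _ * (_ * X)]big1 ?mulr1 ?mul1r.
Qed.

Lemma iint_discretize (mu : probability T R) (I : finType) (F : (I -> T) -> R) :
  iint mu (fun e => F (discretize \o e)) =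
  \sum_(s : {ffun I -> W})
    (\prod_o Rintegral mu setT (cell (s o))) * F (pt \o s).
Proof.
transitivity (iint mu (fun e : I -> T => \sum_(s : {ffun I -> W})
    F (pt \o s) * \prod_o cell (s o) (e o))).
  by congr (iint mu _); apply/funext => e; exact: discretizeE.
rewrite iint_sum => [|s].
  apply: eq_bigr => s _; rewrite mulrC.
  by apply: (iint_tensor mu _ (h := fun i => cell (s i))) => i.
by apply: bp_closure_base; exists (F (pt \o s)), (fun o => cell (s o)).
Qed.

End Discretization.

Section NormOfEmbedding.
Context {R : realType} {d0 : measure_display} {T : measurableType d0}.
Variables (W : nat -> finType) (idx : forall n, T -> W n) (pt : forall n, W n -> T).
Hypothesis midx : forall n w, measurable [set x | idx n x = w].
Variables (Z : Type) (K : Z -> Z -> R) (M : R) (I Theta : finType).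
Variables (c : Theta -> R) (mu : Theta -> probability T R).
Variable V : Theta -> (I -> T) -> Z.
Let D n := discretize (idx n) (@pt n).
Hypothesis Kpsd : psd_kernel K.
Hypothesis KM : forall z z', `|K z z'| <= M.
Hypothesis cvg_one : forall t e z,
  K (V t (D n \o e)) z @[n --> \oo] --> K (V t e) z.
Hypothesis cvg_two : forall t t' e e',
  K (V t (D n \o e)) (V t' (D n \o e')) @[n --> \oo] --> K (V t e) (V t' e').

(** [f] represents the signed measure that gives weight [c t] to the law of [V t] under [mu t]; [S]
    is the energy of that measure, to be identified with the squared norm of [f]. *)
Let f z := \sum_t c t * iint (mu t) (fun e => K (V t e) z).
Let S := \sum_t \sum_t' c t * c t' *
  iint (mu t) (fun e => iint (mu t') (fun e' => K (V t e) (V t' e'))).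

(** After discretization the signed measure has finitely many atoms [z n j], with masses [a n j]:
    the weight [c] times a product of cell probabilities. *)
Let J n : finType := (Theta * {ffun I -> W n})%type.
Let a n (j : J n) := c j.1 *
  \prod_o Rintegral (mu j.1) setT (fun x => (idx n x == j.2 o)%:R).
Let z n (j : J n) := V j.1 (@pt n \o j.2).
Arguments a : clear implicits.
Arguments z : clear implicits.

Let sampleE n (g : Z -> R) :
  \sum_j a n j * g (z n j) =
  \sum_t c t * iint (mu t) (fun e => g (V t (D n \o e))).
Proof.
rewrite -(pair_bigA _ (fun t s => a n (t, s) * g (z n (t, s)))) /=.
apply: eq_bigr => t _; rewrite (iint_discretize (@pt n) (@midx n) (mu t) (fun e => g (V t e))).
by rewrite mulr_sumr; apply: eq_bigr => s _; rewrite /a /= mulrA.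
Qed.

Let mv_one t w : multivariate (fun e => K w (V t e)).
Proof.
apply: (@bp_closure_lim _ _ _ (fun n e => K w (V t (D n \o e))) _ M) => [n|n e|e].
- exact: (multivariate_discretize (@pt n) (@midx n) (fun e => K w (V t e))).
- exact: KM.
- by rewrite Kpsd.1; under eq_fun do rewrite Kpsd.1; exact: cvg_one.
Qed.

Let f_cvg w : \sum_j a n j * K (z n j) w @[n --> \oo] --> f w.
Proof.
under eq_fun => n do rewrite (sampleE n (K^~ w)).
apply: cvg_big => // [|t _]; first exact: add_continuous.
apply: cvgMr; apply: (iint_cvg (M := M)) => [n|n e|e].
- exact: (multivariate_discretize (@pt n) (@midx n) (fun e => K (V t e) w)).
- exact: KM.
- exact: cvg_one.
Qed.

Let S_cvg : \sum_i \sum_j a n i * a n j * K (z n i) (z n j) @[n --> \oo] --> S.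
Proof.
have E n : \sum_i \sum_j a n i * a n j * K (z n i) (z n j) =
  \sum_t \sum_t' c t * c t' * iint (mu t) (fun e => iint (mu t')
    (fun e' => K (V t (D n \o e)) (V t' (D n \o e')))).
  transitivity (\sum_i a n i * \sum_j a n j * K (z n i) (z n j)).
    by apply: eq_bigr => i _; rewrite mulr_sumr; apply: eq_bigr => j _; rewrite mulrA.
  under eq_bigr do rewrite sampleE.
  rewrite (sampleE n (fun w => \sum_t c t * iint (mu t) (fun e => K w (V t (D n \o e))))).
  apply: eq_bigr => t _; rewrite iint_sum => [|t']; last first.
    exact: (multivariate_discretize (@pt n) (@midx n) (fun e =>
      c t' * iint (mu t') (fun e' => K (V t e) (V t' (D n \o e'))))).
  rewrite mulr_sumr; apply: eq_bigr => t' _; rewrite -mulrA; congr (_ * _).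
  apply: iint_scale.
  exact: (multivariate_discretize (@pt n) (@midx n) (fun e => iint (mu t')
    (fun e' => K (V t e) (V t' (D n \o e'))))).
under eq_fun do rewrite E.
apply: cvg_big => // [|t _]; first exact: add_continuous.
apply: cvg_big => // [|t' _]; first exact: add_continuous.
apply: cvgMr.
apply: (iint2_cvg (F := fun n e => K (V t (D n \o (e \o inl))) (V t' (D n \o (e \o inr))))
  (G := fun e => K (V t (e \o inl)) (V t' (e \o inr))) (M := M)) => [n|n e|e].
- exact: (multivariate_discretize (@pt n) (@midx n) (fun e : I + I -> T =>
    K (V t (e \o inl)) (V t' (e \o inr)))).
- exact: KM.
- exact: cvg_two.
Qed.

(** Pairs the discretized measure with the exact [f], so only one of the two arguments of [K] is
    discretized. Sharing the limit [S] with [S_cvg] is what makes the lower bound on the norm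
    sharp. *)
Let Lf_cvg : \sum_j a n j * f (z n j) @[n --> \oo] --> S.
Proof.
have E n : \sum_j a n j * f (z n j) =
  \sum_t \sum_t' c t * c t' * iint (mu t) (fun e => iint (mu t')
    (fun e' => K (V t (D n \o e)) (V t' e'))).
  rewrite sampleE; apply: eq_bigr => t _; rewrite iint_sum => [|t']; last first.
    exact: (multivariate_discretize (@pt n) (@midx n) (fun e =>
      c t' * iint (mu t') (fun e' => K (V t' e') (V t e)))).
  rewrite mulr_sumr; apply: eq_bigr => t' _; rewrite -mulrA; congr (_ * _).
  rewrite -iint_scale; last first.
    exact: (multivariate_discretize (@pt n) (@midx n) (fun e =>
      iint (mu t') (fun e' => K (V t e) (V t' e')))).
  congr (iint _ _); apply/funext => e; congr (_ * iint _ _).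
  by apply/funext => e'; exact: Kpsd.1.
under eq_fun do rewrite E.
apply: cvg_big => // [|t _]; first exact: add_continuous.
apply: cvg_big => // [|t' _]; first exact: add_continuous.
apply: cvgMr.
apply: (iint2_cvg (F := fun n e => K (V t (D n \o (e \o inl))) (V t' (e \o inr)))
  (G := fun e => K (V t (e \o inl)) (V t' (e \o inr))) (M := M)) => [n|n e|e].
(* In the second argument, which stays exact, [K] is multivariate by [mv_one]. *)
- exact: (multivariate_discretize_left (@pt n) (@midx n) (F := fun e e' => K (V t e) (V t' e'))).
- exact: KM.
- exact: cvg_one.
Qed.

Lemma embedding_ge0 : 0 <= S.
Proof. by apply: (cvgr_to_ge S_cvg); apply: nearW => n; exact: psd_sum_ge0. Qed.

(** Cauchy-Schwarz between the test combination and the atoms of the discretized measure, followed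
    by the limit in the discretization. *)
Let f_le n (b : 'I_n -> R) (x : 'I_n -> Z) :
  \sum_p \sum_q b p * b q * K (x p) (x q) <= 1 ->
  `|\sum_p b p * f (x p)| <= Num.sqrt S.
Proof.
move=> b1; rewrite -sqrtr_sqr ler_sqrt ?embedding_ge0//.
have h : (\sum_p b p * \sum_j a k j * K (z k j) (x p)) ^+ 2 @[k --> \oo] -->
    (\sum_p b p * f (x p)) ^+ 2.
  rewrite expr2; under eq_fun do rewrite expr2.
  have h1 : \sum_p b p * \sum_j a k j * K (z k j) (x p) @[k --> \oo] -->
      \sum_p b p * f (x p).
    apply: cvg_big => // [|p _]; first exact: add_continuous.
    by apply: cvgMr; exact: f_cvg.
  exact: cvgM.
apply: (ler_cvg_to h S_cvg); apply: nearW => k.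
have -> : \sum_p b p * \sum_j a k j * K (z k j) (x p) =
    \sum_j \sum_p a k j * b p * K (z k j) (x p).
  rewrite exchange_big; apply: eq_bigr => p _; rewrite mulr_sumr.
  by apply: eq_bigr => j _; rewrite mulrA [b p * _]mulrC.
apply: le_trans (psd_Cauchy_Schwarz _ _ _ _ Kpsd) _.
by rewrite ler_piMr//; exact: psd_sum_ge0.
Qed.

Lemma rkhs_norm_embedding : rkhs_norm K f = (Num.sqrt S)%:E.
Proof.
have ub : (rkhs_norm K f <= (Num.sqrt S)%:E)%E.
  by apply: ge_ereal_sup => _ [n [b [x [b1 ->]]]]; rewrite lee_fin; exact: f_le.
have sup_ge n (b : 'I_n -> R) (x : 'I_n -> Z) :
    \sum_p \sum_q b p * b q * K (x p) (x q) <= 1 ->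
    ((`|\sum_p b p * f (x p)|)%:E <= rkhs_norm K f)%E.
  by move=> b1; apply: ereal_sup_ubound; exists n, b, x.
have ge0 : (0 <= rkhs_norm K f)%E.
  (* The empty combination is always available, even if [Z] is empty; it excludes the value [-oo] of
     the supremum. *)
  have x0 : 'I_0 -> Z by case.
  by have := sup_ge 0 (fun=> 0) x0; rewrite !big_ord0 normr0; exact.
apply/eqP; rewrite eq_le ub /=.
have [S0|S_gt0] := leP S 0; first by rewrite ler0_sqrtr.
case E: (rkhs_norm K f) ge0 ub => [r| |] //; rewrite !lee_fin => r0 _.
have Lf_le : \forall n \near \oo, \sum_j a n j * f (z n j) <=
    r * Num.sqrt (\sum_i \sum_j a n i * a n j * K (z n i) (z n j)).
  apply: filterS (cvgr_gt _ S_cvg _ S_gt0) => n.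
  set Sn := (X in 0 < X -> _) => Sn0.
  have reidx (F : J n -> R) : \sum_j F j = \sum_i F (@enum_val (J n) (J n) i).
    by rewrite (reindex (@enum_val (J n) (J n)))//; exact/onW_bij/enum_val_bij.
  (* The test combination is the discretized measure divided by its norm [Num.sqrt Sn], which is
     positive for large [n] because [S > 0]. *)
  have := @sup_ge #|J n| (fun i => a n (enum_val i) / Num.sqrt Sn)
    (fun i => z n (enum_val i)).
  rewrite -(reidx (fun i => \sum_(q < #|J n|) a n i / Num.sqrt Sn *
    (a n (enum_val q) / Num.sqrt Sn) * K (z n i) (z n (enum_val q)))).
  under eq_bigr => i _ do rewrite -(reidx (fun j => a n i / Num.sqrt Sn *
    (a n j / Num.sqrt Sn) * K (z n i) (z n j))).
  rewrite -(reidx (fun j => a n j / Num.sqrt Sn * f (z n j))).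
  have -> : \sum_i \sum_j a n i / Num.sqrt Sn * (a n j / Num.sqrt Sn) *
      K (z n i) (z n j) = 1.
    transitivity (Sn / Sn); last by rewrite divff// gt_eqF.
    rewrite {1}/Sn mulr_suml; apply: eq_bigr => i _; rewrite mulr_suml.
    apply: eq_bigr => j _; rewrite mulrACA -invfM -expr2 sqr_sqrtr ?(ltW Sn0)//.
    exact: mulrAC.
  rewrite E lee_fin => /(_ (lexx _)) h.
  rewrite -ler_pdivrMr ?sqrtr_gt0//; apply: le_trans h.
  rewrite mulr_suml; under eq_bigr do rewrite mulrAC.
  exact: ler_norm.
have h : r * Num.sqrt (\sum_i \sum_j a n i * a n j * K (z n i) (z n j))
    @[n --> \oo] --> r * Num.sqrt S.
  by apply: cvgMr; exact: (continuous_cvg _ (@sqrt_continuous R S) S_cvg).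
(* The limit reads [S <= r * Num.sqrt S]; one factor [Num.sqrt S] cancels. *)
have := ler_cvg_to Lf_cvg h Lf_le.
by rewrite -{1}(sqr_sqrtr (ltW S_gt0)) expr2 ler_pM2r ?sqrtr_gt0//; exact.
Qed.
Lemma embedding_swap t t' :
  iint (mu t) (fun e => iint (mu t') (fun e' => K (V t e) (V t' e'))) =
  iint (mu t') (fun e => iint (mu t) (fun e' => K (V t' e) (V t e'))).
Proof.
have mK : multivariate (fun e : I + I -> T => K (V t (e \o inl)) (V t' (e \o inr))).
  apply: (bp_closure_lim (F := fun n e => K (V t (D n \o (e \o inl))) (V t' (D n \o (e \o inr))))
    (M := M)) => [n|n e|e].
  - exact: (multivariate_discretize (@pt n) (@midx n) (fun e : I + I -> T =>
    K (V t (e \o inl)) (V t' (e \o inr)))).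
  - exact: KM.
  - exact: cvg_two.
rewrite (iint_swap (mu t) (mu t') mK); congr (iint _ _); apply/funext => e.
by congr (iint _ _); apply/funext => e'; exact: Kpsd.1.
Qed.

End NormOfEmbedding.

(** * The sigma-algebra of a bounded pointwise closure *)

Section ClosureSigmaAlgebra.
Context {R : realType} {T : Type}.
Variable A : (T -> R) -> Prop.
Hypothesis Abd : bounded_class A.
Hypothesis Amul : forall f g, A f -> A g -> A (fun x => f x * g x).
Hypothesis Acst : forall c, A (fun=> c).
Implicit Types f g : T -> R.

Let mul f g := bp_closure_mul Abd Amul (f := f) (g := g).
Let cst c : bp_closure A (fun=> c) := bp_closure_base (Acst c).
Let scale c f : bp_closure A f -> bp_closure A (fun x => c * f x).
Proof. exact: mul. Qed.
Let sub f g : bp_closure A f -> bp_closure A g ->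
  bp_closure A (fun x => f x - g x).
Proof.
move=> fA gA; rewrite (_ : (fun x => _) = fun x => f x + (-1) * g x).
  exact/bp_closure_add/scale.
by apply/funext => x; rewrite mulN1r.
Qed.
Let pow f n : bp_closure A f -> bp_closure A (fun x => f x ^+ n).
Proof.
move=> fA; elim: n => [|n IH]; first exact: cst.
by under eq_fun do rewrite exprS; exact: mul.
Qed.

(* A polynomial iteration in [u] that increases to [`|u|] when [`|u| <= 1]. *)
Let abs_approx (u : R) n := iter n (fun p : R => p + 2^-1 * (u * u - p * p)) 0.

(** One step multiplies the error [|u| - p] by [1 - (|u| + p) / 2], which lies between 0 and
    [1 - |u| / 2] as long as [0 <= p <= |u| <= 1]. *)
Let abs_approx_bounds u n : `|u| <= 1 ->
  [/\ 0 <= abs_approx u n, abs_approx u n <= `|u| &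
      `|u| - abs_approx u n <= `|u| * (1 - 2^-1 * `|u|) ^+ n].
Proof.
move=> u1; have u0 := normr_ge0 u.
elim: n => [|n [h0 h1 h2]]; first by rewrite expr0 mulr1 subr0.
rewrite exprS mulrCA; rewrite /abs_approx iterS -/(abs_approx u n).
have uu : u * u = `|u| * `|u| by rewrite -!expr2 real_normK// num_real.
rewrite uu; move: (abs_approx u n) h0 h1 h2 => p h0 h1 h2.
have : (1 - 2^-1 * `|u|) * (`|u| - p) <=
    (1 - 2^-1 * `|u|) * (`|u| * (1 - 2^-1 * `|u|) ^+ n).
  by apply: ler_wpM2l => //; lra.
move: (_ * (_ * _ ^+ n)) => b hb; move: u0 u1 h0 h1 hb {h2 uu}.
move: `|u| => v v0 v1 p0 pv hb.
by split; nra.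
Qed.

Let abs f : bp_closure A f -> bp_closure A (fun x => `|f x|).
Proof.
move=> fA; have [M fM] := bp_closure_bounded Abd fA.
pose N := `|M| + 1.
have N0 : 0 < N by rewrite ltr_wpDl.
have fN x : `|N^-1 * f x| <= 1.
  rewrite normrM gtr0_norm ?invr_gt0// mulrC ler_pdivrMr// mul1r.
  by apply: le_trans (fM x) _; rewrite ler_wpDr// ler_norm.
rewrite (_ : (fun x => _) = fun x => N * `|N^-1 * f x|); last first.
  by apply/funext => x; rewrite normrM gtr0_norm ?invr_gt0// mulVKf// gt_eqF.
apply: scale; apply: (@bp_closure_lim _ _ _ (fun n x => abs_approx (N^-1 * f x) n) _ 1).
- elim=> [|n IH]; first exact: cst.
  apply: bp_closure_add => //; apply: scale; apply: sub; last exact: mul.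
  by apply: mul; exact: scale.
- move=> n x; have [h0 h1 _] := abs_approx_bounds n (fN x).
  by rewrite ger0_norm// (le_trans h1).
- move=> x; move: (N^-1 * f x) (fN x) => u u1.
  apply: (@squeeze_cvgr _ _ _ _ (fun n => `|u| - `|u| * (1 - 2^-1 * `|u|) ^+ n) (fun=> `|u|)).
  + apply: nearW => n; have [_ h1 h2] := abs_approx_bounds n u1.
    by rewrite h1 andbT; lra.
  (* At [u = 0] the ratio is 1 and its powers do not tend to 0, but the prefactor [|u|] vanishes. *)
  + have lE : `|u| - `|u| * (if u == 0 then 1 else 0) = `|u|.
      by case: eqP => [->|]; rewrite ?normr0 ?mul0r ?mulr0 subr0.
    rewrite -[X in _ --> X]lE {lE}.
    apply: cvgB; first exact: cvg_cst.
    apply: cvgMr; case: eqP => [->|/eqP u0].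
      by apply: cvg_near_cst; apply: nearW => n; rewrite normr0 mulr0 subr0 expr1n.
    have : 0 < `|u| by rewrite normr_gt0.
    by move=> ?; apply: cvg_expr; rewrite ltr_norml; apply/andP; split; lra.
  + exact: cvg_cst.
Qed.

Definition closure_measurable (B : set T) := bp_closure A (\1_B : T -> R).

Lemma closure_measurableC B :
  closure_measurable B -> closure_measurable (~` B).
Proof.
rewrite /closure_measurable => BA.
rewrite (_ : \1_(~` B) = fun x => 1 - \1_B x :> R); first exact: sub.
apply/funext => x; rewrite !indicE in_setC.
by case: (x \in B); rewrite /= ?subr0 ?subrr.
Qed.

Lemma closure_measurable_gt0 f :
  bp_closure A f -> closure_measurable [set x | 0 < f x].
Proof.
move=> fA; rewrite -[X in closure_measurable X]setCK.
apply: closure_measurableC.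
have [M fM] := bp_closure_bounded Abd fA.
pose N := `|M| + 1.
have N0 : 0 < N by rewrite ltr_wpDl.
have fN x : `|f x| <= N.
  by apply: le_trans (fM x) _; rewrite ler_wpDr// ler_norm.
(* [t = 1 - max(f, 0) / N] lies in [0, 1] and equals 1 exactly where [f <= 0], so
   its powers converge to the indicator of [f <= 0]. *)
pose t x := 1 - (2 * N)^-1 * (f x + `|f x|).
have tE x : t x = if 0 < f x then 1 - N^-1 * f x else 1.
  rewrite /t; case: ltP => fx; last by rewrite ler0_norm// subrr mulr0 subr0.
  by rewrite gtr0_norm//; field; rewrite gt_eqF.
have t01 x : 0 <= t x <= 1.
  rewrite tE; case: ltP => fx; last by rewrite lexx ler01.
  rewrite subr_ge0 mulrC ler_pdivrMr// mul1r (le_trans (ler_norm _))//=.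
  by rewrite lerBlDr ler_wpDr// mulr_ge0// ltW// invr_gt0.
apply: (@bp_closure_lim _ _ _ (fun n x => t x ^+ n) _ 1).
- move=> n; apply: pow; apply: sub; first exact: cst.
  by apply: scale; apply: bp_closure_add => //; exact: abs.
- move=> n x; have /andP[t0 t1] := t01 x.
  by rewrite normrX ger0_norm// exprn_ile1.
- move=> x; rewrite indicE in_setC; have := t01 x; rewrite tE.
  have [fx|fx] := ltP 0 (f x).
    move=> /andP[t0 _]; rewrite mem_set//=; apply: cvg_expr.
    by rewrite ger0_norm// ltrBlDr ltrDl mulr_gt0// invr_gt0.
  move=> _; rewrite memNset/=; last by rewrite /= ltNge fx.
  by apply: cvg_near_cst; apply: nearW => n; rewrite expr1n.
Qed.

Lemma closure_measurable_bigcap (B : nat -> set T) :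
  (forall n, closure_measurable (B n)) -> closure_measurable (\bigcap_n B n).
Proof.
move=> BA; apply: (@bp_closure_lim _ _ _ (fun n x => \prod_(i < n) \1_(B i) x) _ 1).
- elim=> [|n IH].
    by under eq_fun do rewrite big_ord0; exact: cst.
  by under eq_fun do rewrite big_ord_recr /=; apply: mul => //; exact: BA.
- move=> n x; rewrite normr_prod; apply: prodr_ile1 => i _.
  by rewrite normr_ge0 indicE; case: (_ \in _); rewrite normr_nat ?lexx ?ler01.
- move=> x; rewrite indicE; have [/= xB|] := pselect ((\bigcap_n B n) x).
    rewrite mem_set//; apply: cvg_near_cst; apply: nearW => n.
    by rewrite big1 => // i _; rewrite indicE mem_set//; exact: xB.
  move=> xB; rewrite memNset//=; move: xB => /existsNP[m /not_implyP[_ xm]].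
  apply: cvg_near_cst; exists m.+1 => // n /= mn.
  by rewrite (bigD1 (Ordinal mn)) //= indicE memNset// mul0r.
Qed.

Lemma closure_measurable_bigcup (B : nat -> set T) :
  (forall n, closure_measurable (B n)) -> closure_measurable (\bigcup_n B n).
Proof.
move=> BA; rewrite -[X in closure_measurable X]setCK setC_bigcup.
apply/closure_measurableC/closure_measurable_bigcap => n.
exact: closure_measurableC.
Qed.

Lemma closure_measurableI B C : closure_measurable B -> closure_measurable C ->
  closure_measurable (B `&` C).
Proof. by rewrite /closure_measurable indicI; exact: mul. Qed.

Lemma closure_measurableT : closure_measurable setT.
Proof. by rewrite /closure_measurable indicT; exact: cst. Qed.

Lemma closure_measurable0 : closure_measurable set0.
Proof. by rewrite -setCT; exact/closure_measurableC/closure_measurableT. Qed.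

End ClosureSigmaAlgebra.

(** * Equality of integrals passes to the closure *)

Section EqualIntegrals.
Context {R : realType} {d0 : measure_display} {T : measurableType d0}.
Variables (gamma eta : probability T R) (A : (T -> R) -> Prop).
Hypothesis Abd : bounded_class A.
Hypothesis Ameas : forall f, A f -> measurable_fun setT f.
Hypothesis Aint : forall f, A f ->
  Rintegral gamma setT f = Rintegral eta setT f.

Lemma bp_closure_Rintegral f : bp_closure A f ->
  measurable_fun setT f /\ Rintegral gamma setT f = Rintegral eta setT f.
Proof.
elim=> {f} [f Af|f g fA [mf IHf] gA [mg IHg]|F f M FA IH FM Ff].
- by split; [exact: Ameas|exact: Aint].
- split; first exact: measurable_funD.
  have [M fM] := bp_closure_bounded Abd fA.
  have [N gN] := bp_closure_bounded Abd gA.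
  rewrite !RintegralD ?IHf ?IHg//.
  + exact: bounded_integrable mf fM.
  + exact: bounded_integrable mg gN.
  + exact: bounded_integrable mf fM.
  + exact: bounded_integrable mg gN.
- have mF n := (IH n).1.
  have [mf hg] := measurable_Rintegral_cvg gamma mF FM Ff.
  have [_ he] := measurable_Rintegral_cvg eta mF FM Ff.
  split=> //; apply: (cvg_unique _ hg); first exact: Rhausdorff.
  rewrite (_ : (fun n => Rintegral gamma _ _) = fun n => Rintegral eta setT (F n))//.
  by apply/funext => n; exact: (IH n).2.
Qed.

Lemma closure_measurable_eq B : closure_measurable A B ->
  measurable B /\ gamma B = eta B.
Proof.
move=> /bp_closure_Rintegral[mB intB].
have {}mB : measurable B.
  rewrite (_ : B = setT `&` (\1_B : T -> R) @^-1` [set 1]); first exact: mB.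
  rewrite setTI; apply/seteqP; split=> x /=; first by move=> Bx; rewrite indicE mem_set.
  rewrite indicE; case: (boolP (x \in B)) => [/set_mem//|_ /= /eqP].
  by rewrite eq_sym oner_eq0.
split=> //; move: intB; rewrite /Rintegral !integral_indic// !setIT => gB.
rewrite -[LHS]fineK; last exact: fin_num_measure.
by rewrite gB fineK//; exact: fin_num_measure.
Qed.

End EqualIntegrals.

(** * Compact sets belong to the sigma-algebra *)

Section CompactSeparation.
Context {R : realType} {Y : topologicalType}.
Variables (g : nat -> Y -> R) (K : set Y).
Hypothesis gcont : forall n, continuous (g n).
Hypothesis gsep : forall x y, (forall n, g n x = g n y) -> x = y.
Hypothesis Kcompact : compact K.

(** Otherwise some sequence in [K] agrees with [x] ever more closely on ever more of the [g l]. A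
    cluster point in [K] then agrees with [x] on all of them, so it equals [x]. A single [n] serves
    both as number of functions and as inverse precision. *)
Lemma compact_separation x : ~ K x ->
  exists n, forall y, K y -> exists2 l, (l < n)%N & n%:R^-1 <= `|g l x - g l y|.
Proof.
move=> Kx; apply: contrapT => /forallNP h.
have /choice[y yP] : forall n, exists y, K y /\
    forall l, (l < n.+1)%N -> `|g l x - g l y| < n.+1%:R^-1.
  move=> n; have /existsNP[y /not_implyP[Ky hy]] := h n.+1.
  exists y; split=> // l ln; rewrite ltNge; apply/negP => hl.
  by apply: hy; exists l.
have [p [Kp yp]] : K `&` cluster (y @ \oo) !=set0.
  by apply: (Kcompact (F := y @ \oo)); exists 0%N => // n _; exact: (yP n).1.
apply: Kx; rewrite (_ : x = p)//; apply: gsep => l; apply: contrapT => /eqP glxp.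
pose e := `|g l x - g l p| / 2.
have e0 : 0 < e by rewrite divr_gt0// normr_gt0 subr_eq0.
have /cvgrPdist_lt/(_ _ e0) hp := @gcont l p.
have hy : (y @ \oo) [set z | `|g l x - g l z| < e].
  have he : \forall n \near \oo, n.+1%:R^-1 < e.
    exact: (near_infty_natSinv_lt (PosNum e0)).
  have hl : \forall n \near \oo, (l < n.+1)%N by exists l.
  apply: filterS2 he hl => n /= ne ln; apply: lt_trans ne.
  exact: (yP n).2.
have [z [/= z1 z2]] := yp _ _ hy hp.
have : `|g l x - g l p| <= `|g l x - g l z| + `|g l p - g l z|.
  by rewrite -[`|g l p - _|]normrN opprB; apply: le_trans (ler_normD _ _); rewrite addrA subrK.
rewrite leNgt => /negP; apply.
by rewrite [ltRHS]splitr ltrD.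
Qed.

Variable A : (Y -> R) -> Prop.
Hypothesis Abd : bounded_class A.
Hypothesis Amul : forall f g, A f -> A g -> A (fun x => f x * g x).
Hypothesis Acst : forall c, A (fun=> c).
Hypothesis gA : forall n, A (g n).

(** With [n = size s], a cell prescribes the integer parts of [n * g l] for all [l < n], so two of
    its points differ by less than [1 / n] on each of these functions. Integer sequences are
    countable. *)
Let cell (s : seq int) : set Y := [set x | forall l, (l < size s)%N ->
  (s`_l)%:~R <= (size s)%:R * g l x < (s`_l)%:~R + 1].

Let closure_measurable_cell s : closure_measurable A (cell s).
Proof.
pose B l := if (l < size s)%N then
  ~` [set x | 0 < (s`_l)%:~R - (size s)%:R * g l x] `&`
  [set x | 0 < ((s`_l)%:~R + 1) - (size s)%:R * g l x] else setT.
rewrite (_ : cell s = \bigcap_l B l).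
  apply: closure_measurable_bigcap => // l; rewrite /B.
  case: ifP => _; last exact: closure_measurableT.
  have lin c : bp_closure A (fun x => c - (size s)%:R * g l x).
    apply: bp_closure_add; first exact: bp_closure_base.
    rewrite (_ : (fun x => _) = fun x => - (size s)%:R * g l x); last first.
      by apply/funext => x; rewrite mulNr.
    by apply/bp_closure_base/Amul.
  apply: closure_measurableI => //.
    by apply: closure_measurableC => //; exact: closure_measurable_gt0.
  exact: closure_measurable_gt0.
apply/seteqP; split=> x.
  move=> h l _; rewrite /B; case: ifP => // ls; have /andP[h1 h2] := h l ls.
  by split=> /=; rewrite subr_gt0 ?h2// ltNge h1.
move=> h l ls; have := h l I; rewrite /B ls => -[/=].
by rewrite !subr_gt0 ltNge => /negP; rewrite negbK => -> ->.
Qed.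

(** The complement of [K] is the union of the countably many cells that miss [K]: around a point
    outside [K], the cell at the scale given by [compact_separation] cannot meet [K]. *)
Lemma compact_closure_measurable : closure_measurable A K.
Proof.
rewrite -[K]setCK; apply: closure_measurableC => //.
pose F n := if unpickle n is Some s then
  if `[< cell s `&` K = set0 >] then cell s else set0 else set0.
rewrite (_ : ~` K = \bigcup_n F n).
  apply: closure_measurable_bigcup => // n; rewrite /F.
  case: unpickle => [s|]; last exact: closure_measurable0.
  by case: ifP => _; [exact: closure_measurable_cell|exact: closure_measurable0].
apply/seteqP; split=> x; last first.
  move=> [n _]; rewrite /F; case: unpickle => // s; case: ifPn => // /asboolP.
  by move=> sK sx Kx; have : (cell s `&` K) x by []; rewrite sK.
move=> /= /compact_separation[n hn].
pose s := mkseq (fun l => Num.floor (n%:R * g l x)) n.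
have sx : cell s x.
  move=> l; rewrite size_mkseq => ln; rewrite nth_mkseq//.
  by have := floor_itv (n%:R * g l x); rewrite intrD1.
exists (pickle s) => //; rewrite /F pickleK asboolT//.
apply/seteqP; split=> // y [sy /hn[l ln]].
apply/negP; rewrite -ltNge.
move: (sx l) (sy l); rewrite size_mkseq ln => /(_ isT) /andP[x1 x2] /(_ isT) /andP[y1 y2].
have n0 : 0 < n%:R :> R by rewrite ltr0n (leq_ltn_trans _ ln).
rewrite -[ltRHS]mul1r ltr_pdivlMr// -[X in _ * X]gtr0_norm// -normrM mulrC mulrBr.
rewrite ltr_norml; apply/andP; split; lra.
Qed.

End CompactSeparation.

(** * Products of Polish spaces *)

Lemma ultra_bigcup_lt {T : Type} (F : set_system T) (B : nat -> set T) n :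
  UltraFilter F -> F (\bigcup_(m in [set m | (m < n)%N]) B m) ->
  exists m, F (B m).
Proof.
move=> FU; have FP : ProperFilter F by exact: ultra_proper.
elim: n => [/filter_ex[x []//]|n IH FB].
have [?|FBC] := in_ultra_setVsetC (B n) FU; first by exists n.
apply: IH; apply: filterS (filterI FBC FB) => x [xn [m /= mn xm]].
exists m => //=; move: mn; rewrite ltnS leq_eqVlt => /predU1P[mE|//].
by case: xn; rewrite -mE.
Qed.

Section PolishProduct.
Context {R : realType} {d : nat} {X : 'I_d -> completePseudoMetricType R}.

Lemma polish_dense_sequence (T : completePseudoMetricType R) : polish T ->
  exists y : nat -> T, forall (x : T) (r : R), 0 < r -> exists n, ball (y n) r x.
Proof.
move=> [_ [D [/pfcard_geP[D0|[f]] Ddense]]].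
  (* The space is pointed, so a dense set cannot be empty. *)
  have : closure D point by rewrite Ddense.
  by rewrite D0 closure0.
exists f => x r r0; have /(_ (ball x r))[|z [Dz xz]] : closure D x by rewrite Ddense.
  exact: nbhsx_ballx.
have [n _ nz] := @surj _ _ _ _ f z Dz.
by exists n; rewrite nz; exact: ball_sym.
Qed.

Lemma continuous_proj (j : 'I_d) : continuous (fun x : prodX X => x j).
Proof. exact: (@proj_continuous _ (fun j => X j : ptopologicalType) j). Qed.

Lemma measurable_open_proj (j : 'I_d) (U : set (X j)) : open U ->
  measurable [set x : BorelX X | U (x j)].
Proof.
move=> oU; apply: sub_sigma_algebra.
exact: (@open_comp (prodX X) (X j) (fun x => x j) U (fun x _ => @continuous_proj j x) oU).
Qed.

Lemma measurable_continuous (f : prodX X -> R) : continuous f ->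
  measurable_fun [set: BorelX X] (f : BorelX X -> R).
Proof.
move=> cf; apply: (measurability _ (RGenOpens.measurableE R)).
move=> _ [_ [a [b ->]] <-]; rewrite setTI; apply: sub_sigma_algebra.
apply: (@open_comp (prodX X) R f) => [x _|]; [exact: cf|exact: interval_open].
Qed.

Variable y : forall j, nat -> X j.
Hypothesis ydense : forall j (x : X j) (r : R), 0 < r -> exists n, ball (y j n) r x.

Definition small_open j (r m : nat) : set (X j) := (ball (y j m) r.+1%:R^-1)°.

Lemma small_open_cover j r (x : X j) : exists m, small_open r m x.
Proof.
pose s : R := r.+1%:R^-1; have s0 : 0 < s by rewrite invr_gt0.
(* Half the radius, so that a neighbourhood of [x] still fits inside the ball. *)
have [m xm] := ydense x (divr_gt0 s0 (ltr0n _ 2)).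
exists m; apply: filterS (nbhsx_ballx x _ (divr_gt0 s0 (ltr0n _ 2))) => z xz.
by rewrite -/s [s]splitr; exact: ball_triangle xm xz.
Qed.

Let good r n := [set x : BorelX X | forall j, exists2 m, (m < n)%N & small_open r m (x j)].

Let measurable_good r n : measurable (good r n).
Proof.
rewrite (_ : good r n = \bigcap_(j in [set: 'I_d]) \bigcup_(m in [set m | (m < n)%N])
    [set x : BorelX X | small_open r m (x j)]).
  apply: fin_bigcap_measurable => [|j _]; first exact: finite_finset.
  by apply: bigcup_measurable => m _; apply: measurable_open_proj; exact: open_interior.
apply/seteqP; split=> x /=.
  by move=> h j _; have [m mn xm] := h j; exists m.
by move=> h j; have [m mn xm] := h j I; exists m.
Qed.

Let good_cover r : \bigcap_n ~` good r n = set0.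
Proof.
apply/seteqP; split=> // x h; have /choice[m xm] : forall j, exists m, small_open r m (x j).
  by move=> j; exact: small_open_cover.
apply: (h (\max_j (m j)).+1 I) => j; exists (m j) => //.
by rewrite ltnS; exact: (leq_bigmax_cond (F := m) j).
Qed.

Let good_measure (mu : probability (BorelX X) R) r (e : R) : 0 < e ->
  exists n, (mu (~` good r n) <= e%:E)%E.
Proof.
move=> e0.
have mC n : measurable (~` good r n) by exact: measurableC.
have : (mu \o (fun n => ~` good r n)) n @[n --> \oo] --> mu (\bigcap_n ~` good r n).
  apply: nonincreasing_cvg_mu => //.
  - by apply: le_lt_trans (ltry 1); exact: probability_le1.
  - by rewrite good_cover.
  - move=> n m nm; apply/subsetPset; apply: subsetC => x h j.
    by have [l ln xl] := h j; exists l => //; exact: leq_trans ln nm.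
rewrite good_cover measure0 => /fine_cvgP[_ /cvgrPdist_lt/(_ _ e0)[n _ /(_ n (leqnn n))]].
rewrite /= sub0r normrN => h; exists n.
rewrite -[leLHS]fineK; last exact: fin_num_measure.
by rewrite lee_fin; apply: le_trans (ltW h); exact: ler_norm.
Qed.

(** At every scale finitely many balls cover the set, so an ultrafilter on it contains one of them
    and is therefore Cauchy; completeness supplies the limit. *)
Let totally_bounded_compact j (n : nat -> nat) :
  compact (closure (\bigcap_r [set x : X j | exists2 m, (m < n r)%N & small_open r m x])).
Proof.
set B := \bigcap_r _.
rewrite compact_ultra => F FU FB.
have FP : ProperFilter F by exact: ultra_proper.
have cF : cauchy F.
  apply: cauchy_exP => e e0.
  have e20 : 0 < e / 2 by rewrite divr_gt0.
  have [r re] : exists r : nat, r.+1%:R^-1 < e / 2.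
    by have [r _ /(_ r (leqnn r))] := near_infty_natSinv_lt (PosNum e20); exists r.
  (* One half of [e] pays for passing to the closure, the other for the radius of the small ball. *)
  have sub : closure B `<=` \bigcup_(m in [set m | (m < n r)%N]) ball (y j m) e.
    move=> x /(_ (ball x (e / 2)))[|b [/(_ r I)[m mn bm] xb]]; first exact: nbhsx_ballx.
    exists m => //; rewrite [e]splitr; apply: ball_triangle (ball_sym xb).
    by apply: le_ball (interior_subset bm); exact: ltW.
  have [m Fm] := ultra_bigcup_lt FU (filterS sub FB).
  by exists (y j m).
have Fp : F --> lim F by exact: cauchy_cvg.
exists (lim F); split=> //; apply: (@closed_closure _ B) => V Vp.
exact: filter_ex (filterI FB (Fp _ Vp)).
Qed.

(** Ulam's theorem. The compact set is a product of compact sets, one per coordinate. The estimate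
    is stated for a measurable [E] containing its complement, so that measurability of [K] is not at
    stake. *)
Lemma probability_tight (mu : probability (BorelX X) R) (e : R) : 0 < e ->
  exists (K : set (prodX X)) (E : set (BorelX X)),
    [/\ compact K, measurable E, ~` K `<=` E & (mu E <= e%:E)%E].
Proof.
move=> e0.
have /choice[n nP] : forall r, exists n, (mu (~` good r n) <= (e / (2 ^ r.+1)%:R)%:E)%E.
  by move=> r; apply: good_measure; rewrite divr_gt0// ltr0n expn_gt0.
pose C j := closure (\bigcap_r [set x : X j | exists2 m, (m < n r)%N & small_open r m x]).
exists [set x | forall j, C j (x j)], (\bigcup_r ~` good r (n r)).
have mE : measurable (\bigcup_r ~` good r (n r)).
  by apply: bigcup_measurable => r _; exact: measurableC.
split=> //.
- by apply: tychonoff => j; exact: totally_bounded_compact.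
- move=> x /= /existsNP[j xj]; apply: contrapT => h; apply: xj.
  apply: subset_closure => r _; apply: contrapT => hr; apply: h.
  by exists r => // /(_ j).
- apply: le_trans (epsilon_trick0 xpredT (ltW e0)).
  have h : (mu (\bigcup_r ~` good r (n r)) <= \sum_(r <oo) mu (~` good r (n r)))%E.
    by apply: measure_sigma_subadditive => // r; exact: measurableC.
  by apply: le_trans h _; apply: lee_nneseries => r _ //; exact: nP.
Qed.

End PolishProduct.

(** * Moments determine the law *)

Lemma cvg_ball_inv {R : realType} {T : pseudoMetricType R} (u : nat -> T) (x : T) :
  (forall r : nat, \forall n \near \oo, ball x r.+1%:R^-1 (u n)) ->
  u n @[n --> \oo] --> x.
Proof.
move=> h; apply/cvg_ballP => e e0.
have [r _ /(_ r (leqnn r)) /= re] := near_infty_natSinv_lt (PosNum e0).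
by apply: filterS (h r) => n; apply: le_ball; exact: ltW.
Qed.

Section KernelProduct.
Context {R : realType} {d : nat} {X : 'I_d -> completePseudoMetricType R}.
Variable k : forall j : 'I_d, X j -> X j -> R.
Hypothesis hker : forall j, psd_kernel (@k j).
Hypothesis hbdd : forall j, bounded_kernel (@k j).
Hypothesis hcont : forall j, continuous_kernel (@k j).

Lemma cvg_kernel j (u v : nat -> X j) (x x' : X j) :
  u n @[n --> \oo] --> x -> v n @[n --> \oo] --> x' ->
  k (u n) (v n) @[n --> \oo] --> k x x'.
Proof.
move=> ux vx.
exact: (@continuous_cvg _ _ _ _ _ (fun n => (u n, v n)) (fun p => k p.1 p.2)
  (x, x') (@hcont j (x, x')) (cvg_pair ux vx)).
Qed.

Lemma continuous_kernel_proj j (z : X j) :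
  continuous (fun x : prodX X => k (x j) z).
Proof.
move=> x; apply: (@continuous_comp _ _ _ (fun x : prodX X => (x j, z)) (fun p => k p.1 p.2)).
  by apply: cvg_pair; [exact: (@continuous_proj R d X j x)|exact: cvg_cst].
exact: hcont.
Qed.

Lemma bounded_measurable_kernel j (z : X j) :
  bounded_measurable (fun x : BorelX X => k (x j) z).
Proof.
split; first exact: (measurable_continuous (@continuous_kernel_proj j z)).
by have [M _ kM] := psd_bounded_norm (hker j) (hbdd j); exists M => x; exact: kM.
Qed.

(** With lists of tagged points, the product of monomials is concatenation, the constant 1 is
    [[::]], and the degree is the length. *)
Definition monomial (s : seq {j : 'I_d & X j}) (x : BorelX X) : R :=
  \prod_(t <- s) k (x (tag t)) (tagged t).

Lemma bounded_measurable_monomial s : bounded_measurable (monomial s).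
Proof. by apply: bounded_measurable_prod => t; exact: bounded_measurable_kernel. Qed.

Definition moment (mu : probability (BorelX X) R) s := Rintegral mu setT (monomial s).

Section MomentsDetermine.
Hypothesis hpolish : forall j, polish (X j).
Hypothesis hsep : forall j, point_separating (@k j).
Variables gamma eta : probability (BorelX X) R.
Hypothesis moment_eq : forall s, moment gamma s = moment eta s.

Let A (f : BorelX X -> R) := exists c s, f = fun x => c * monomial s x.

Let Abm f : A f -> bounded_measurable f.
Proof.
move=> [c [s ->]]; apply: bounded_measurableM; last exact: bounded_measurable_monomial.
by split; [exact: measurable_cst|exists `|c|].
Qed.

Let Abd : bounded_class A. Proof. by move=> f /Abm[]. Qed.

Let Amul f g : A f -> A g -> A (fun x => f x * g x).
Proof.
move=> [c [s ->]] [c' [s' ->]]; exists (c * c'), (s ++ s').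
by apply/funext => x; rewrite /monomial big_cat mulrACA.
Qed.

Let Acst c : A (fun=> c).
Proof.
by exists c, [::]; apply/funext => x; rewrite /monomial big_nil mulr1.
Qed.

Let Aint f : A f -> Rintegral gamma setT f = Rintegral eta setT f.
Proof.
move=> [c [s ->]]; have [ms [M sM]] := bounded_measurable_monomial s.
rewrite !RintegralZl//; [|exact: bounded_integrable ms sM..].
by congr (_ * _); exact: moment_eq.
Qed.

Let y j : nat -> X j := projT1 (cid (polish_dense_sequence (hpolish j))).

Let ydense j (x : X j) (r : R) : 0 < r -> exists n, ball (y j n) r x.
Proof. exact: (projT2 (cid (polish_dense_sequence (hpolish j)))). Qed.

(** Enumerates the countably many kernel sections at the dense points [y j m], through the coding of
    pairs [(j, m)]. *)
Let g (n : nat) (x : prodX X) : R :=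
  if unpickle n is Some (j, m) then k (x j) (y j m) else 0.

Let gA n : A (g n).
Proof.
rewrite /g; case: (unpickle n : option ('I_d * nat)) => [[j m]|]; last exact: Acst.
exists 1, [:: existT _ j (y j m)]; apply/funext => x.
by rewrite /monomial big_seq1 mul1r.
Qed.

Let gcont n : continuous (g n).
Proof.
rewrite /g; case: (unpickle n : option ('I_d * nat)) => [[j m]|].
  exact: continuous_kernel_proj.
by move=> x; exact: cvg_cst.
Qed.

(** Agreement at the dense points extends by continuity of the kernel to all second arguments; point
    separation then applies in each coordinate. *)
Let gsep x x' : (forall n, g n x = g n x') -> x = x'.
Proof.
move=> gxx'; apply: functional_extensionality_dep => j; apply: hsep.
apply/funext => z.
have /choice[m mz] : forall r : nat, exists m, ball (y j m) (r.+1%:R^-1) z.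
  by move=> r; apply: ydense; rewrite invr_gt0.
have yz : y j (m r) @[r --> \oo] --> z.
  apply: cvg_ball_inv => r; exists r => // n /= rn; apply: ball_sym.
  by apply: le_ball (mz n); rewrite lef_pV2 ?posrE// ler_nat.
have h1 : k (x j) (y j (m r)) @[r --> \oo] --> k (x j) z.
  by apply: cvg_kernel => //; exact: cvg_cst.
apply: (cvg_unique _ h1); first exact: Rhausdorff.
rewrite (_ : (fun r => k (x j) _) = fun r => k (x' j) (y j (m r))).
  by apply: cvg_kernel => //; exact: cvg_cst.
by apply/funext => r; have := gxx' (pickle (j, m r)); rewrite /g pickleK.
Qed.

Let compact_measure_eq (K : set (prodX X)) : compact K ->
  measurable (K : set (BorelX X)) /\ gamma K = eta K.
Proof.
move=> Kc; apply: (closure_measurable_eq Abd (fun f Af => (Abm Af).1) Aint).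
exact: (compact_closure_measurable gcont gsep Kc Abd Amul Acst gA).
Qed.

Let closed_measurable (C : set (prodX X)) : closed C ->
  measurable (C : set (BorelX X)).
Proof.
move=> cC; rewrite -[C]setCK; apply: measurableC.
by apply: sub_sigma_algebra; exact: closed_openC.
Qed.

(** Up to mass [e], [C] may be replaced by its intersection with a compact [K], which is compact and
    so has the same mass under [nu]. The two measures are then interchanged to get equality. *)
Let closed_le (mu nu : probability (BorelX X) R) (C : set (prodX X)) :
  (forall K, compact K -> measurable (K : set (BorelX X)) /\ mu K = nu K) ->
  closed C -> (mu C <= nu C)%E.
Proof.
move=> munu cC; apply/lee_addgt0Pr => e e0.
have [K [E [Kc mE KE muE]]] := probability_tight ydense mu e0.
have [mCK CK] := munu _ (compact_closedI Kc cC).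
have mC := closed_measurable cC.
have h1 : (mu C <= mu ((K `&` C) `|` E))%E.
  apply: le_measure; rewrite ?inE//; first exact: measurableU.
  move=> x Cx; have [Kx|/KE ?] := pselect (K x); [by left|by right].
apply: (le_trans h1); apply: (le_trans (measureU2 _ mCK mE)).
apply: leeD => //; rewrite [leLHS]CK; apply: le_measure; rewrite ?inE//.
Qed.

(** Equality passes from closed to open sets by complements; the open sets are stable under
    intersection and generate the sigma-algebra. *)
Lemma moments_determine B : measurable B -> gamma B = eta B.
Proof.
have closed_eq C : closed C -> gamma C = eta C.
  move=> cC; apply/eqP; rewrite eq_le; apply/andP; split; apply: closed_le => // K Kc.
  by have [? ->] := compact_measure_eq Kc.
apply: (@measure_unique _ R (BorelX X) (@open (prodX X)) (fun=> setT) _ _ _ _ gamma eta) => //.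
- by move=> U V; exact: openI.
- by move=> _; exact: openT.
- by apply/seteqP; split=> // x _; exists 0%N.
- move=> U oU; have mU : measurable (U : set (BorelX X)) by exact: sub_sigma_algebra.
  have := closed_eq _ (open_closedC oU).
  rewrite !probability_setC// => h.
  rewrite -[LHS]fineK; last exact: fin_num_measure.
  rewrite -[RHS]fineK; last exact: fin_num_measure.
  have e1 (mu : probability (BorelX X) R) : (1 - mu U)%E = (1 - fine (mu U))%:E.
    by rewrite EFinB fineK//; exact: fin_num_measure.
  move: h; rewrite !e1 => -[/(congr1 (fun r => 1 - r))]; rewrite !subKr => ->.
  by [].
- by move=> _; apply: le_lt_trans (ltry 1); exact: probability_le1.
Qed.

End MomentsDetermine.

(** * Discretization of the product space *)

Variable y : forall j, nat -> X j.
Hypothesis ydense : forall j (x : X j) (r : R), 0 < r -> exists n, ball (y j n) r x.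

(** A cell records, for each coordinate, each of the first [n] scales and each of the first [n]
    dense points, whether the coordinate lies in the corresponding small open set. *)
Definition grid (n : nat) : finType := {ffun 'I_d * 'I_n * 'I_n -> bool}.

Definition grid_idx n (x : BorelX X) : grid n :=
  [ffun p : 'I_d * 'I_n * 'I_n => `[< small_open y p.1.2 p.2 (x p.1.1) >]].

(* The value of [get] is arbitrary on an empty cell, but [grid_idx] only ever
   returns nonempty ones. *)
Definition grid_pt n (w : grid n) : BorelX X :=
  get [set x : prodX X | grid_idx n x = w].

Lemma measurable_grid_idx n w : measurable [set x | grid_idx n x = w].
Proof.
rewrite (_ : [set x | _] = \bigcap_(p in [set: 'I_d * 'I_n * 'I_n])
    (if w p then [set x : BorelX X | small_open y p.1.2 p.2 (x p.1.1)]
     else ~` [set x : BorelX X | small_open y p.1.2 p.2 (x p.1.1)])).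
  apply: fin_bigcap_measurable => [|p _]; first exact: finite_finset.
  have mp : measurable [set x : BorelX X | small_open y p.1.2 p.2 (x p.1.1)].
    by apply: measurable_open_proj; exact: open_interior.
  by case: (w p) => //; exact: measurableC.
apply/seteqP; split=> x /=.
  by move=> <- p _; rewrite ffunE; case: asboolP.
move=> h; apply/ffunP => p; have := h p I; rewrite ffunE.
by case: (w p) => [/asboolT//|/asboolF].
Qed.

Lemma cvg_grid j (x : BorelX X) :
  discretize (grid_idx n) (@grid_pt n) x j @[n --> \oo] --> (x j : X j).
Proof.
apply: cvg_ball_inv => r.
(* At scale [r.*2.+1] the radius is [1 / (2 r + 2)]. The point and its representative share such a
   ball, so they are within twice that, [1 / (r + 1)]. *)
have [m xm] := small_open_cover ydense r.*2.+1 (x j).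
exists (maxn r.*2.+1 m).+1 => // n /= nm.
have rn : (r.*2.+1 < n)%N by apply: leq_trans nm; rewrite ltnS leq_maxl.
have mn : (m < n)%N by apply: leq_trans nm; rewrite ltnS leq_maxr.
have := @getPex (prodX X) [set x' | grid_idx n x' = grid_idx n x] (ex_intro _ x erefl).
move=> /ffunP/(_ (j, Ordinal rn, Ordinal mn)); rewrite !ffunE /= => h.
have xm' : small_open y r.*2.+1 m (grid_pt (grid_idx n x) j).
  by apply/asboolP; rewrite /grid_pt h; exact/asboolP.
have -> : r.+1%:R^-1 = r.*2.+2%:R^-1 + r.*2.+2%:R^-1 :> R.
  by rewrite -doubleS -mul2n natrM invfM; field; rewrite nat1r pnatr_eq0.
apply: ball_triangle (interior_subset xm').
exact: ball_sym (interior_subset xm).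
Qed.

End KernelProduct.

(** * Cumulants determine moments *)

Section Regroup.
Context {d : nat} {T : 'I_d -> Type}.

Let at_index l (t : {j : 'I_d & T j}) : option (T l) :=
  match tag t =P l with
  | ReflectT e => Some (ecast j (T j) e (tagged t))
  | ReflectF _ => None
  end.

Let big_at_index (S : Type) (idx : S) (op : Monoid.com_law idx) F t :
  \big[op/idx]_l oapp (fun v => F (existT T l v)) idx (at_index l t) = F t.
Proof.
case: t => j v; have atj : at_index j (existT T j v) = Some v.
  by rewrite /at_index /=; case: eqP => // e; rewrite (eq_axiomK e).
rewrite (bigD1 j) //= big1 => [|l lj]; first by rewrite atj Monoid.mulm1.
by rewrite /at_index /=; case: eqP => // e; exfalso; move: lj; rewrite -e eqxx.
Qed.

(* Sorting a list of tagged points by tag fills the slots of a multi-index. *)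
Lemma regroup_slots (x0 : forall l, T l) (s : seq {j : 'I_d & T j}) :
  exists (i : 'I_d -> nat) (z : forall u : slot i, T (tag u)),
  forall (S : Type) (idx : S) (op : Monoid.com_law idx) F,
    \big[op/idx]_(t <- s) F t = \big[op/idx]_(u : slot i) F (existT T (tag u) (z u)).
Proof.
pose L l := pmap (at_index l) s.
exists (fun l => size (L l)), (fun u : slot (fun l => size (L l)) =>
  nth (x0 (tag u)) (L (tag u)) (tagged u : 'I_(size (L (tag u))))).
move=> S idx op F.
transitivity (\big[op/idx]_l \big[op/idx]_(v <- L l) F (existT T l v)).
  rewrite /L; elim: s {L} => [|t s IH].
    by rewrite big_nil big1// => l _; rewrite big_nil.
  rewrite big_cons IH -(big_at_index op F t) -big_split; apply: eq_bigr => l _ /=.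
  by case: (at_index l t) => [v|] /=; rewrite ?big_cons// Monoid.mul1m.
rewrite (eq_bigr (fun l => \big[op/idx]_(r < size (L l)) F (existT T l (nth (x0 l) (L l) r)))).
  by rewrite (sig_big_dep xpredT (fun _ => xpredT)
    (fun l (r : 'I_(size (L l))) => F (existT T l (nth (x0 l) (L l) r)))).
by move=> l _; rewrite (big_nth (x0 l)) big_mkord.
Qed.

End Regroup.

Section CumulantsMoments.
Context {R : realType} {d : nat} {X : 'I_d -> completePseudoMetricType R}.
Variable k : forall j : 'I_d, X j -> X j -> R.
Hypothesis hker : forall j, psd_kernel (@k j).
Hypothesis hbdd : forall j, bounded_kernel (@k j).
Hypothesis hcont : forall j, continuous_kernel (@k j).

Let moment_nil mu : moment k mu [::] = 1.
Proof.
rewrite /moment (_ : monomial k [::] = fun=> 1) ?Rintegral_cst_probability//.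
by apply/funext => x; rewrite /monomial big_nil.
Qed.

(** For fixed [z] the kernel factors over blocks, and each block reads its own copy of the variable.
    The product runs over all subsets of slots; a subset that is no block of a partition contributes
    the moment of the empty list, which is 1. *)
Lemma Epart_kten (mu : probability (BorelX X) R) (i : 'I_d -> nat)
    (P : {set {set slot i}}) (z : slotpt X i) :
  Epart mu P (fun w => kten k i w z) =
  \prod_(B : {set slot i}) moment k mu
    [seq existT _ (tag u) (z u) | u <- enum [pred u | finset.pblock P u == B]].
Proof.
pose h (B : {set slot i}) (x : BorelX X) : R :=
  \prod_(u | finset.pblock P u == B) k (x (tag u)) (z u).
have hE B : h B = monomial k
    [seq existT _ (tag u) (z u) | u <- enum [pred u | finset.pblock P u == B]].
  by apply/funext => x; rewrite /monomial big_map big_enum.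
transitivity (iint mu (fun e : {set slot i} -> BorelX X => 1 * \prod_B h B (e B))).
  congr (iint mu _); apply/funext => e; rewrite mul1r /kten.
  rewrite (partition_big (finset.pblock P) xpredT) //=.
  apply: eq_bigr => B _; apply: eq_bigr => u /eqP uB.
  by rewrite /part_vector uB.
rewrite iint_tensor ?mul1r => [|B].
  by apply: eq_bigr => B _; rewrite hE.
by rewrite hE; exact: bounded_measurable_monomial.
Qed.

Lemma cumulants_moments (gamma eta : probability (BorelX X) R) :
  (forall i, (0 < deg i)%N -> kcumulant k gamma i = kcumulant k eta i) ->
  forall s, moment k gamma s = moment k eta s.
Proof.
move=> kap s; have [n] := ubnP (size s); elim: n s => // n IH s sn.
have [i [z zE]] := regroup_slots (fun l => point : X l) s.
(* The same regrouping, read with [addn] and constant 1, counts the slots. *)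
have sz : size s = #|slot i|.
  by rewrite -sum1_size (zE _ _ addn (fun=> 1%N)) sum1_card.
(* The empty list has degree 0, where no cumulant is given, but its moment is 1 under every
   probability. *)
have [s0|s0] := posnP (size s).
  by have -> : s = [::] by [exact/size0nil]; rewrite !moment_nil.
have [u0 _] : exists u0 : slot i, u0 \in slot i by apply/card_gt0P; rewrite -sz.
have degi : (0 < deg i)%N.
  rewrite /deg (bigD1 (tag u0)) //= addn_gt0.
  by rewrite (leq_ltn_trans _ (ltn_ord (tagged u0 : 'I_(i (tag u0))))).
pose m mu (P : {set {set slot i}}) (B : {set slot i}) := moment k mu
    [seq existT _ (tag u) (z u) | u <- enum [pred u | finset.pblock P u == B]].
pose P0 : {set {set slot i}} := [set [set: slot i]]%SET.
have P0part : P0 \in partitions i.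
  rewrite inE /finset.partition /finset.cover big_set1 eqxx finset.trivIset1.
  rewrite finset.in_set1 eq_sym; apply/finset.set0Pn; exists u0.
  by rewrite finset.in_setT.
have pblockP0 u : finset.pblock P0 u = [set: slot i]%SET.
  by apply: finset.def_pblock; rewrite ?finset.trivIset1 ?finset.in_set1 ?finset.in_setT.
(* If some [B] received every slot, [P] would be the one-block partition. Otherwise the list
   attached to [B] is strictly shorter than [s], and induction applies. *)
have mlow P B : P \in partitions i -> P != P0 -> m gamma P B = m eta P B.
  rewrite inE => /and3P[/eqP covP trivP P_0] PP0; apply: IH.
  rewrite size_map -cardE; rewrite ltnS sz in sn; apply: leq_trans sn.
  apply: proper_card; apply/properP; split; first exact/fintype.subsetP.
  suff /existsP[u uB] : [exists u, finset.pblock P u != B] by exists u.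
  apply: contraR PP0 => /existsPn h.
  have {}h u : finset.pblock P u = B by apply/eqP; rewrite -[_ == _]negbK h.
  have PB : P = [set B]%SET.
    apply/finset.setP => C; rewrite finset.in_set1; apply/idP/eqP => [PC|->].
      have /finset.set0Pn[u uC] : C != finset.set0 by apply: contraNneq P_0 => <-.
      by rewrite -(h u); symmetry; exact: finset.def_pblock.
    by rewrite -(h u0) finset.pblock_mem// covP finset.in_setT.
  by rewrite /P0 -covP PB /finset.cover big_set1.
have mP0 mu : \prod_B m mu P0 B = moment k mu s.
  rewrite (bigD1 [set: slot i]%SET) //= big1 => [|B BT].
    rewrite mulr1; congr (Rintegral mu setT _); apply/funext => x.
    rewrite /monomial big_map big_enum (zE _ _ *%R) /=.
    by apply: eq_bigl => u; rewrite inE pblockP0 eqxx.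
  rewrite /m (_ : enum _ = [::]) ?moment_nil// -[RHS](enum0 (slot i)).
  by apply: eq_enum => u; rewrite !inE pblockP0 eq_sym (negbTE BT).
have := congr1 (fun f => f z) (kap i degi); rewrite /kcumulant.
rewrite !(bigD1 P0 P0part) /= !Epart_kten !mP0.
rewrite (eq_bigr (fun P => cpart R P * Epart eta P (fun w => kten k i w z))); last first.
  move=> P /andP[PP PP0]; rewrite !Epart_kten; congr (_ * _).
  by apply: eq_bigr => B _; exact: mlow.
(* The remaining terms cancel, and the one-block partition has coefficient 1. *)
move/addIr; rewrite /cpart cards1 /= expr0 fact0 !mul1r.
exact.
Qed.

End CumulantsMoments.

(** * The distance formula *)

Section CumulantDistance.
Context {R : realType} {d : nat} {X : 'I_d -> completePseudoMetricType R}.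
Variable k : forall j : 'I_d, X j -> X j -> R.
Hypothesis hker : forall j, psd_kernel (@k j).
Hypothesis hbdd : forall j, bounded_kernel (@k j).
Hypothesis hcont : forall j, continuous_kernel (@k j).
Variable i : 'I_d -> nat.

Lemma psd_kten : psd_kernel (kten k i).
Proof.
apply: (@psd_prod _ _ _ _ (fun (s : slot i) (z z' : slotpt X i) => k (z s) (z' s))) => s.
exact: (psd_comap (fun z : slotpt X i => z s)).
Qed.

Lemma bounded_kten : exists M, forall z z', `|kten k i z z'| <= M.
Proof.
have /choice[M kM] : forall j, exists M, forall x x' : X j, `|k x x'| <= M.
  by move=> j; have [M _ kM] := psd_bounded_norm (hker j) (hbdd j); exists M.
exists (\prod_(s : slot i) M (tag s)) => z z'; rewrite normr_prod.
by apply: ler_prod => s _; rewrite normr_ge0 kM.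
Qed.

Hypothesis hpolish : forall j, polish (X j).

Let y j : nat -> X j := projT1 (cid (polish_dense_sequence (hpolish j))).

Let ydense j (x : X j) (r : R) : 0 < r -> exists n, ball (y j n) r x.
Proof. exact: (projT2 (cid (polish_dense_sequence (hpolish j)))). Qed.

Let Dn n := discretize (grid_idx y n) (@grid_pt _ _ _ y n).

Let cvg_kten (u v : nat -> slotpt X i) z z' :
  (forall s, u n s @[n --> \oo] --> z s) -> (forall s, v n s @[n --> \oo] --> z' s) ->
  kten k i (u n) (v n) @[n --> \oo] --> kten k i z z'.
Proof.
move=> uz vz; apply: cvg_big => [|s _]; first exact: mul_continuous.
exact: cvg_kernel.
Qed.

Let cvg_part (P : {set {set slot i}}) (e : {set slot i} -> BorelX X) s :
  part_vector P (fun B => Dn n (e B)) s @[n --> \oo] --> part_vector P e s.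
Proof. exact: cvg_grid. Qed.

Variables gamma eta : probability (BorelX X) R.

(** The difference of the two cumulants as one signed combination: the boolean selects the measure
    and the sign, and families that are not partitions get weight 0, so that the index can be a full
    finite type. *)
Let Theta : finType := (bool * {set {set slot i}})%type.
Let mu (t : Theta) := if t.1 then gamma else eta.
Let c (t : Theta) : R :=
  if t.2 \in partitions i then (if t.1 then cpart R t.2 else - cpart R t.2) else 0.
Let V (t : Theta) (e : {set slot i} -> BorelX X) : slotpt X i := part_vector t.2 e.

Lemma kcumulant_distance :
  ((rkhs_norm (kten k i)
      (fun z => (kcumulant k gamma i z - kcumulant k eta i z)%R)) ^+ 2)%E =
   (\sum_(P in partitions i) \sum_(Q in partitions i)
      cpart R P * cpart R Q *
      (Epart2 gamma gamma P Q (kten k i)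
       + Epart2 eta eta P Q (kten k i)
       - 2 * Epart2 gamma eta P Q (kten k i)))%:E.
Proof.
have [M KM] := bounded_kten.
have cvg_one t e z : kten k i (V t (Dn n \o e)) z @[n --> \oo] --> kten k i (V t e) z.
  by apply: cvg_kten => s; [exact: cvg_part|exact: cvg_cst].
have cvg_two t t' e e' :
    kten k i (V t (Dn n \o e)) (V t' (Dn n \o e')) @[n --> \oo] --> kten k i (V t e) (V t' e').
  by apply: cvg_kten => s; exact: cvg_part.
have midx := @measurable_grid_idx R d X y.
pose E t t' := iint (mu t) (fun e => iint (mu t') (fun e' => kten k i (V t e) (V t' e'))).
have E_ge0 : 0 <= \sum_t \sum_t' c t * c t' * E t t' :=
  embedding_ge0 midx c mu psd_kten KM cvg_two.
have norm_eq : rkhs_norm (kten k i)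
    (fun z => \sum_t c t * iint (mu t) (fun e => kten k i (V t e) z)) =
    (Num.sqrt (\sum_t \sum_t' c t * c t' * E t t'))%:E :=
  rkhs_norm_embedding midx c mu psd_kten KM cvg_one cvg_two.
have swap t t' : E t t' = E t' t := embedding_swap midx mu psd_kten KM cvg_two t t'.
have sumTheta (F : Theta -> R) : (forall b P, P \notin partitions i -> F (b, P) = 0) ->
    \sum_t F t = \sum_(P in partitions i) (F (true, P) + F (false, P)).
  move=> F0; transitivity (\sum_b \sum_P F (b, P)).
    by rewrite pair_bigA; apply: eq_bigr => -[].
  rewrite big_bool -big_split /=.
  rewrite (bigID (mem (partitions i))) /= [X in _ + X]big1 ?addr0// => P PP.
  by rewrite !F0// addr0.
have c0 b P : P \notin partitions i -> c (b, P) = 0 by rewrite /c => /negbTE ->.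
have cT P : P \in partitions i -> c (true, P) = cpart R P by rewrite /c /= => ->.
have cF P : P \in partitions i -> c (false, P) = - cpart R P by rewrite /c /= => ->.
rewrite (_ : (fun z => _) =
    fun z => \sum_t c t * iint (mu t) (fun e => kten k i (V t e) z)); last first.
  apply/funext => z; rewrite /kcumulant -sumrB sumTheta => [|b P /c0->]; last by rewrite mul0r.
  by apply: eq_bigr => P PP; rewrite cT// cF// mulNr.
rewrite norm_eq -EFin_expe sqr_sqrtr//; congr (_%:E).
rewrite sumTheta => [|b P PP]; last first.
  by rewrite big1// => t' _; rewrite c0// !mul0r.
pose e b P b' Q := E (b, P) (b', Q).
have -> : \sum_(P in partitions i) (\sum_t' c (true, P) * c t' * E (true, P) t' +
      \sum_t' c (false, P) * c t' * E (false, P) t') =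
   \sum_(P in partitions i) \sum_(Q in partitions i) cpart R P * cpart R Q *
     (e true P true Q + e false P false Q - e true P false Q) -
   \sum_(P in partitions i) \sum_(Q in partitions i) cpart R P * cpart R Q *
     e false P true Q.
  rewrite -sumrB; apply: eq_bigr => P PP.
  rewrite !sumTheta => [|b Q QQ|b Q QQ]; try by rewrite c0// mulr0 mul0r.
  rewrite -sumrB -big_split; apply: eq_bigr => Q QQ /=.
  by rewrite !cT// !cF// /e; ring.
(* The two mixed terms coincide after renaming [P] and [Q] and exchanging the integrals, whence the
   factor 2. *)
rewrite [X in _ - X]exchange_big -sumrB; apply: eq_bigr => P PP.
rewrite -sumrB; apply: eq_bigr => Q QQ.
rewrite /e [E (false, Q) (true, P)]swap -!/(E _ _).
rewrite (_ : Epart2 gamma gamma P Q _ = E (true, P) (true, Q))//.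
rewrite (_ : Epart2 eta eta P Q _ = E (false, P) (false, Q))//.
rewrite (_ : Epart2 gamma eta P Q _ = E (true, P) (false, Q))//.
by rewrite [cpart R Q * cpart R P]mulrC; ring.
Qed.
End CumulantDistance.

(** * Characterization of laws by cumulants, with the distance formula *)

Theorem theorem2 (R : realType) (d : nat) (X : 'I_d -> completePseudoMetricType R)
  (k : forall j : 'I_d, X j -> X j -> R)
  (hpolish : forall j, polish (X j))
  (hker : forall j, psd_kernel (k j))
  (hbdd : forall j, bounded_kernel (k j))
  (hcont : forall j, continuous_kernel (k j))
  (hsep : forall j, point_separating (k j))
  (gamma eta : probability (BorelX X) R) :
  ((forall A : set (BorelX X), measurable A -> gamma A = eta A) <->
   (forall i : 'I_d -> nat, (0 < deg i)%N ->
      kcumulant k gamma i = kcumulant k eta i)) /\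
  (forall i : 'I_d -> nat, (0 < deg i)%N ->
     ((rkhs_norm (kten k i)
        (fun z => (kcumulant k gamma i z - kcumulant k eta i z)%R)) ^+ 2)%E =
     (\sum_(P in partitions i) \sum_(Q in partitions i)
        cpart R P * cpart R Q *
        (Epart2 gamma gamma P Q (kten k i)
         + Epart2 eta eta P Q (kten k i)
         - 2 * Epart2 gamma eta P Q (kten k i)))%:E).
Proof.
split; last by move=> i _; exact: kcumulant_distance.
split=> [ge i _|kap].
  apply/funext => z; apply: eq_bigr => P _; congr (_ * _).
  exact: iint_eq_measure.
apply: (moments_determine hker hbdd hcont hpolish hsep).
exact: cumulants_moments.
Qed.
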